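(* If $X\subseteq\omega$ is not arithmetical, then there is a Turing degree which is high for tight descending sequences and does not compute $X$.
   Context: For a linear order $\mathcal L$, a tight descending sequence is an infinite descending sequence $f$ which is unbounded below in the ill-founded part of $\mathcal L$: for every descending sequence $g$ in $\mathcal L$ and every $n$ there is $m$ with $f(m)<_{\mathcal L}g(n)$. A degree $\mathbf d$ is high for tight descending sequences if every computable ill-founded linear order has a $\mathbf d$-computable tight descending sequence. *)

(* Defs.v *)
From mathcomp Require Import all_boot.
From mathcomp Require Import boolp classical_sets.

Set Implicit Arguments.
Unset Strict Implicit.
Unset Printing Implicit Defensive.

Local Open Scope classical_set_scope.

(* Kleene's schemes for the partial recursive functions with an oracle. Codes  *)
(* are untyped: a code denotes a partial function on argument lists, which is  *)
(* only ever used at a fixed arity; missing arguments are read as 0.           *)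
Inductive code : Type :=
| Zero
| Succ
| Proj of nat
| Query
| Comp of code & seq code
| Prec of code & code
| Mu of code.

(* [eval O c v y]: with oracle O, the computation of c on v halts with value y *)
Inductive eval (O : nat -> nat) : code -> seq nat -> nat -> Prop :=
| eval_zero v : eval O Zero v 0
| eval_succ v : eval O Succ v (nth 0 v 0).+1
| eval_proj i v : eval O (Proj i) v (nth 0 v i)
| eval_query v : eval O Query v (O (nth 0 v 0))
| eval_comp f gs v ws y :
    size ws = size gs ->
    (forall i, i < size gs -> eval O (nth Zero gs i) v (nth 0 ws i)) ->
    eval O f ws y ->
    eval O (Comp f gs) v y
| eval_prec0 f g v y :
    eval O f v y -> eval O (Prec f g) (0 :: v) y
| eval_precS f g n v z y :
    eval O (Prec f g) (n :: v) z ->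
    eval O g [:: n, z & v] y ->
    eval O (Prec f g) (n.+1 :: v) y
| eval_mu f v n (w : nat -> nat) :
    (forall m, m < n -> eval O f (m :: v) (w m).+1) ->
    eval O f (n :: v) 0 ->
    eval O (Mu f) v n.

Definition chi (A : set nat) (x : nat) : nat := `[< A x >].

Definition fun_computable_in (A : set nat) (f : nat -> nat) : Prop :=
  exists c, forall x, eval (chi A) c [:: x] (f x).

Definition rel_computable_in (A : set nat) (k : nat) (P : seq nat -> Prop) : Prop :=
  exists c, forall v, size v = k -> eval (chi A) c v `[< P v >].

Definition turing_le (B A : set nat) : Prop := fun_computable_in A (chi B).

Definition turing_equiv (B A : set nat) : Prop := turing_le B A /\ turing_le A B.

Record turing_degree : Type := TuringDegree {
  degree_sets : set (set nat);
  degree_class : exists A, forall B, degree_sets B <-> turing_equiv B A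
}.

Definition degree_computes_fun (d : turing_degree) (f : nat -> nat) : Prop :=
  exists2 A, degree_sets d A & fun_computable_in A f.

Definition degree_computes_set (d : turing_degree) (X : set nat) : Prop :=
  exists2 A, degree_sets d A & turing_le X A.

(* Q y_1 Q' y_2 Q y_3 ... P (x, y_1, ..., y_n), with n alternating quantifiers *)
(* of which the first one is existential iff ex is true.                       *)
Fixpoint alternating (ex : bool) (n : nat) (P : seq nat -> Prop) (v : seq nat) : Prop :=
  if n is m.+1 then
    if ex then exists y, alternating false m P (rcons v y)
    else forall y, alternating true m P (rcons v y)
  else P v.

Definition in_hierarchy (ex : bool) (n : nat) (X : set nat) : Prop :=
  exists2 P, rel_computable_in set0 n.+1 P &
    forall x, X x <-> alternating ex n P [:: x].

Definition Sigma0 := in_hierarchy true.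
Definition Pi0 := in_hierarchy false.

Definition arithmetical (X : set nat) : Prop :=
  exists n, Sigma0 n X \/ Pi0 n X.

Record linear_order : Type := LinearOrder {
  lo_dom : set nat;
  lo_lt : nat -> nat -> Prop;
  lo_lt_dom : forall x y, lo_lt x y -> lo_dom x /\ lo_dom y;
  lo_lt_irrefl : forall x, ~ lo_lt x x;
  lo_lt_trans : forall x y z, lo_lt x y -> lo_lt y z -> lo_lt x z;
  lo_lt_total : forall x y, lo_dom x -> lo_dom y -> [\/ lo_lt x y, x = y | lo_lt y x]
}.

Definition computable_order (L : linear_order) : Prop :=
  rel_computable_in set0 1 (fun v => lo_dom L (nth 0 v 0)) /\
  rel_computable_in set0 2 (fun v => lo_lt L (nth 0 v 0) (nth 0 v 1)).

Definition descending (L : linear_order) (f : nat -> nat) : Prop :=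
  forall n, lo_lt L (f n.+1) (f n).

Definition ill_founded (L : linear_order) : Prop := exists f, descending L f.

Definition tight_descending (L : linear_order) (f : nat -> nat) : Prop :=
  descending L f /\
  forall g, descending L g -> forall n, exists m, lo_lt L (f m) (g n).

Definition high_for_tight_descending (d : turing_degree) : Prop :=
  forall L, computable_order L -> ill_founded L ->
    exists2 f, tight_descending L f & degree_computes_fun d f.

(* Main.v *)
Require Import Defs.
From mathcomp Require Import all_boot.
From mathcomp Require Import boolp classical_sets.

(* The degree is that of a set [D] built by finite approximations, whose i-th   *)
(* column is, up to finitely many elements, a coinitial subset of the           *)
(* ill-founded part I_i of the i-th computable order; such a column computes a  *)
(* tight descending sequence. Suppose that no extension of an approximation     *)
(* diagonalizes against the computation of X by a given code. Replace, in each  *)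
(* column whose I_i is not arithmetical, the constraint "in I_i" by "above v_i",*)
(* and let A be the set of tuples v for which all finite sets obeying the new   *)
(* constraints give consistent answers. Then A holds on the tuples of points of *)
(* the I_i, where only correct answers arise, and fails on the tuples of points *)
(* of the well-founded parts, where all correct answers arise: otherwise X      *)
(* would be arithmetical. A compactness argument shows that such an             *)
(* arithmetical A exists only if some I_i is arithmetical, a contradiction.     *)

Set Implicit Arguments.
Unset Strict Implicit.
Unset Printing Implicit Defensive.

(** * Oracle computations *)

(** Membership in the ill-founded part [I_i] of a computable order is in general only an analytic
    property, so failure to diagonalize does not by itself define [X] arithmetically. The remedy is
    a sandwich. Since [I_i] is closed upwards, the constraint that a point lie above [v_i] is
    stronger than membership in [I_i] when [v_i] is in [I_i], and weaker when [v_i] is a point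
    outside. If a stronger constraint allows a wrong answer, the finite set giving this answer
    extends the condition and diagonalizes. If a weaker constraint never allows the right answer at
    some argument, the condition already prevents every set it admits from computing [X] by the
    given code. If neither happens, consistency of the answers, arithmetical in [v], separates the
    tuples inside from the tuples outside. This is [extends_avoid].

    By [separated_arith], such a separator makes some [I_j] arithmetical, although only columns with
    non-arithmetical [I_j] received the new constraint. The compactness used there is [arith_path]:
    an infinite arithmetical binary tree has an arithmetical path.

    [generic_exists] alternates this diagonalization with [extends_column], which puts elements of
    the column below every point of [I_i]; [tight_computable] then searches the column for a tight
    descending sequence. The working notion of definability is [arith], linked to computations by
    [arith_eval] and to the arithmetical hierarchy by [arith_arithmetical]. *)

Lemma code_nested_ind (P : code -> Prop) :
  P Zero -> P Succ -> (forall i, P (Proj i)) -> P Query ->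
  (forall f gs, P f -> (forall i, i < size gs -> P (nth Zero gs i)) ->
    P (Comp f gs)) ->
  (forall f g, P f -> P g -> P (Prec f g)) ->
  (forall f, P f -> P (Mu f)) -> forall c, P c.
Proof.
move=> hz hs hp hq hc hr hm; fix IH 1 => -[||i||f gs|f g|f].
- exact: hz.
- exact: hs.
- exact: hp.
- exact: hq.
- apply: hc; first exact: IH.
  (* Codes nest through the list in [Comp]; an inner recursion on that list supplies the hypotheses
     for its members. *)
  move: gs; fix IHs 1 => -[|g gs] [|i] lt_i;
    [by case: (notF lt_i) | by case: (notF lt_i) | exact: (IH g) |].
  exact: (IHs gs i lt_i).
- by apply: hr; exact: IH.
- by apply: hm; exact: IH.
Qed.

Lemma eval_comp_inv O f gs v y : eval O (Comp f gs) v y ->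
  exists ws, [/\ size ws = size gs,
    forall i, i < size gs -> eval O (nth Zero gs i) v (nth 0 ws i) &
    eval O f ws y].
Proof. by move=> h; inversion h; subst; exists ws. Qed.

Lemma eval_prec_inv O f g v y : eval O (Prec f g) v y ->
  exists n w, v = n :: w /\
    if n is m.+1 then exists2 z, eval O (Prec f g) (m :: w) z &
                                 eval O g [:: m, z & w] y
    else eval O f w y.
Proof.
move=> h; inversion h; subst; first by exists 0, v0.
by exists n.+1, v0; split=> //; exists z.
Qed.

Lemma eval_mu_inv O f v n : eval O (Mu f) v n ->
  (forall m, m < n -> exists w, eval O f (m :: v) w.+1) /\ eval O f (n :: v) 0.
Proof. by move=> h; inversion h; subst; split=> // m /H0 e; exists (w m). Qed.

Lemma eval_det O c v y z : eval O c v y -> eval O c v z -> y = z.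
Proof.
move=> h; elim: h z => {c v y}.
- by move=> v z h; inversion h.
- by move=> v z h; inversion h.
- by move=> i v z h; inversion h.
- by move=> v z h; inversion h.
- move=> f gs v ws y sz _ IHg _ IHf z /eval_comp_inv [ws' [sz' hg hf]].
  apply: IHf; suff -> : ws = ws' by [].
  apply: (@eq_from_nth _ 0); first by rewrite sz sz'.
  by move=> i; rewrite sz => lt_i; exact: IHg (hg _ lt_i).
- by move=> f g v y _ IH z /eval_prec_inv [n [w [[<- <-]]]] /IH.
- move=> f g n v z y _ IH1 _ IH2 z' /eval_prec_inv [m [w [[<- <-]]]].
  by case=> z1 /IH1 <- /IH2.
- move=> f v n w _ IH1 _ IH2 z /eval_mu_inv [h1 h2].
  case: (ltngtP n z) => // lt_nz.
    by have [w' /IH2] := h1 _ lt_nz.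
  by have := IH1 _ lt_nz _ h2.
Qed.

Lemma bounded_choice (P : nat -> nat -> Prop) k :
  (forall i m n, m <= n -> P i m -> P i n) ->
  (forall i, i < k -> exists n, P i n) -> exists n, forall i, i < k -> P i n.
Proof.
move=> mono; elim: k => [|k IH] h; first by exists 0.
have [n hn] := IH (fun i lt_i => h i (ltnW lt_i)).
have [m hm] := h k (ltnSn k).
exists (maxn n m) => i; rewrite ltnS leq_eqVlt => /orP[/eqP ->|lt_i].
  exact: mono (leq_maxr _ _) hm.
exact: mono (leq_maxl _ _) (hn _ lt_i).
Qed.

(** The use principle: a halting computation is a finite tree, so it asks finitely many queries. *)
Lemma eval_use O c v y : eval O c v y ->
  exists N, forall O', (forall x, x < N -> O' x = O x) -> eval O' c v y.
Proof.
move=> h; elim: h => {c v y}.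
- by move=> v; exists 0 => *; constructor.
- by move=> v; exists 0 => *; constructor.
- by move=> i v; exists 0 => *; constructor.
- by move=> v; exists (nth 0 v 0).+1 => O' <- //; constructor.
- move=> f gs v ws y sz _ IHg _ [N hN].
  have [|M hM] := @bounded_choice (fun i M => forall O',
    (forall x, x < M -> O' x = O x) -> eval O' (nth Zero gs i) v (nth 0 ws i))
      (size gs) _ IHg.
    by move=> i m n le_mn h O' e; apply: h => x lt_x; apply/e/(leq_trans lt_x).
  exists (maxn N M) => O' e; apply: (eval_comp sz) => [i lt_i|].
    by apply: hM => // x lt_x; apply: e; rewrite leq_max lt_x orbT.
  by apply: hN => x lt_x; apply: e; rewrite leq_max lt_x.
- by move=> f g v y _ [N hN]; exists N => O' /hN ?; constructor.
- move=> f g n v z y _ [N hN] _ [M hM]; exists (maxn N M) => O' e.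
  apply: eval_precS; [apply: hN | apply: hM] => x lt_x; apply: e;
    by rewrite leq_max lt_x ?orbT.
- move=> f v n w _ IH _ [N hN].
  have [|M hM] := @bounded_choice (fun i M => forall O',
    (forall x, x < M -> O' x = O x) -> eval O' f (i :: v) (w i).+1) n _ IH.
    by move=> i m n' le_mn h O' e; apply: h => x lt_x; apply/e/(leq_trans lt_x).
  exists (maxn N M) => O' e; apply: (@eval_mu _ _ _ _ w) => [m lt_m|].
    by apply: hM => // x lt_x; apply: e; rewrite leq_max lt_x orbT.
  by apply: hN => x lt_x; apply: e; rewrite leq_max lt_x.
Qed.

(** [Query] looks at its first argument only, whereas [q] will be known to be correct on one-element
    lists; hence the [Proj 0]. *)
Fixpoint subst_query (q c : code) : code :=
  match c with
  | Query => Comp q [:: Proj 0]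
  | Comp f gs => Comp (subst_query q f) (map (subst_query q) gs)
  | Prec f g => Prec (subst_query q f) (subst_query q g)
  | Mu f => Mu (subst_query q f)
  | c => c
  end.

Lemma eval_subst_query O O' q c v y :
  (forall x, eval O' q [:: x] (O x)) -> eval O c v y ->
  eval O' (subst_query q c) v y.
Proof.
move=> hq; elim=> {c v y} /=; try by move=> *; constructor.
- move=> v; apply: (@eval_comp _ _ _ _ [:: nth 0 v 0]) => //.
  by case=> // _; exact: eval_proj.
- move=> f gs v ws y sz _ IHg _ IHf; apply: (@eval_comp _ _ _ _ ws) => //.
    by rewrite size_map.
  by move=> i; rewrite size_map => lt_i; rewrite (nth_map Zero) //; exact: IHg.
- by move=> *; apply: eval_precS; eassumption.
- by move=> *; apply: eval_mu; eassumption.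
Qed.

Lemma turing_le_trans A B C : turing_le A B -> turing_le B C -> turing_le A C.
Proof.
by move=> [c hc] [q hq]; exists (subst_query q c) => x; exact: eval_subst_query (hc x).
Qed.

Lemma turing_le_refl A : turing_le A A.
Proof. by exists Query => x; exact: (eval_query _ [:: x]). Qed.

(** * Closure properties of computable functions *)

(** For boolean [f] this is convertible to [rel_computable_in], so the closure lemmas apply to
    relations as well. *)
Definition computes (O : nat -> nat) k (f : seq nat -> nat) :=
  exists c, forall v, size v = k -> eval O c v (f v).

Lemma eq_computes O k f g :
  (forall v, size v = k -> f v = g v) -> computes O k f -> computes O k g.
Proof. by move=> e [c hc]; exists c => v sz; rewrite -e //; exact: hc. Qed.

Lemma computes_nth O k i : computes O k (fun v => nth 0 v i).
Proof. by exists (Proj i) => v _; constructor. Qed.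

Lemma computes_comp O k f (gs : seq (seq nat -> nat)) :
  computes O (size gs) f ->
  (forall i, i < size gs -> computes O k (nth (fun=> 0) gs i)) ->
  computes O k (fun v => f [seq g v | g <- gs]).
Proof.
move=> [c hc] hg.
have [cs hcs] : exists cs, size cs = size gs /\ forall i, i < size gs ->
   forall v, size v = k -> eval O (nth Zero cs i) v (nth (fun=> 0) gs i v).
  elim: {c hc} gs hg => [|g gs IH] hg; first by exists [::].
  have [cs [sz hcs]] := IH (fun i => hg i.+1).
  have [c hc] := hg 0 (ltn0Sn _).
  by exists (c :: cs); split=> [|[|i]] //=; rewrite ?sz // => /hcs.
exists (Comp c cs) => v sz; apply: (@eval_comp _ _ _ _ [seq g v | g <- gs]).
- by rewrite size_map hcs.1.
- move=> i; rewrite hcs.1 => lt_i; rewrite (nth_map (fun=> 0)) //.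
  exact: hcs.2.
- by apply: hc; rewrite size_map.
Qed.

Lemma computes1 O k (f : nat -> nat) g :
  computes O 1 (fun v => f (nth 0 v 0)) -> computes O k g ->
  computes O k (fun v => f (g v)).
Proof.
by move=> hf hg; apply: (@computes_comp O k _ [:: g]) hf _ => -[|].
Qed.

Lemma computes2 O k (f : nat -> nat -> nat) g h :
  computes O 2 (fun v => f (nth 0 v 0) (nth 0 v 1)) ->
  computes O k g -> computes O k h -> computes O k (fun v => f (g v) (h v)).
Proof.
by move=> hf hg hh; apply: (@computes_comp O k _ [:: g; h]) hf _ => -[|[|]].
Qed.

Lemma computes_succ O k g : computes O k g -> computes O k (fun v => (g v).+1).
Proof. by apply: computes1; exists Succ => v _; constructor. Qed.

Lemma computes_const O k n : computes O k (fun=> n).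
Proof.
elim: n => [|n IH]; last exact: computes_succ.
by exists Zero => v _; constructor.
Qed.

Lemma computes_rec O (f : nat -> nat -> nat) a b :
  (forall y, f 0 y = a y) -> (forall n y, f n.+1 y = b n (f n y) y) ->
  computes O 1 (fun v => a (nth 0 v 0)) ->
  computes O 3 (fun v => b (nth 0 v 0) (nth 0 v 1) (nth 0 v 2)) ->
  computes O 2 (fun v => f (nth 0 v 0) (nth 0 v 1)).
Proof.
move=> f0 fS [ca ha] [cb hb]; exists (Prec ca cb) => -[|n [|y []]] //= _.
elim: n => [|n IH]; first by apply: eval_prec0; rewrite f0; exact: (ha [:: y]).
by apply: eval_precS IH _; rewrite fS; exact: (hb [:: _; _; _]).
Qed.

Lemma computes_rec0 O (f : nat -> nat) b :
  (forall n, f n.+1 = b n (f n)) ->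
  computes O 2 (fun v => b (nth 0 v 0) (nth 0 v 1)) ->
  computes O 1 (fun v => f (nth 0 v 0)).
Proof.
move=> fS hb.
(* A dummy parameter brings the recursion into the form of [computes_rec]; both arguments are then
   read from the single input. *)
pose F n (_ : nat) := f n.
apply: (@computes2 _ _ F _ _ _ (computes_nth _ _ 0) (computes_nth _ _ 0)).
apply: (@computes_rec _ _ (fun=> f 0) (fun n z _ => b n z)) => // [n y||].
- exact: fS.
- exact: computes_const.
- by apply: computes2 hb _ _; exact: computes_nth.
Qed.

Lemma computes_add O k g h : computes O k g -> computes O k h ->
  computes O k (fun v => g v + h v).
Proof.
apply: computes2; apply: (@computes_rec _ _ id (fun _ z _ => z.+1)) => //.
  exact: computes_nth.
by apply: computes_succ; exact: computes_nth.
Qed.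

Lemma computes_mul O k g h : computes O k g -> computes O k h ->
  computes O k (fun v => g v * h v).
Proof.
apply: computes2; apply: (@computes_rec _ _ (fun=> 0) (fun _ z y => y + z)) => //.
  exact: computes_const.
by apply: computes_add; exact: computes_nth.
Qed.

Lemma computes_pred O k g : computes O k g -> computes O k (fun v => (g v).-1).
Proof.
apply: computes1; apply: (@computes_rec0 _ predn (fun n _ => n)) => //.
exact: computes_nth.
Qed.

Lemma computes_sub O k g h : computes O k g -> computes O k h ->
  computes O k (fun v => g v - h v).
Proof.
move=> hg hh; apply: (@computes2 _ _ (fun n m => m - n) h g _ hh hg).
apply: (@computes_rec _ (fun n m => m - n) id (fun _ z _ => z.-1)).
- exact: subn0.
- by move=> n y; rewrite subnS.
- exact: computes_nth.
- by apply: computes_pred; exact: computes_nth.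
Qed.

Lemma computes_negb O k (g : seq nat -> bool) :
  computes O k g -> computes O k (fun v => ~~ g v).
Proof.
move=> hg; apply: eq_computes (computes_sub (computes_const O k 1) hg) => v _.
by case: (g v).
Qed.

Lemma computes_andb O k (g h : seq nat -> bool) :
  computes O k g -> computes O k h -> computes O k (fun v => g v && h v).
Proof.
by move=> hg hh; apply: eq_computes (computes_mul hg hh) => v _; rewrite mulnb.
Qed.

Lemma computes_eq0 O k g : computes O k g -> computes O k (fun v => g v == 0).
Proof.
move=> hg; apply: eq_computes (computes_sub (computes_const O k 1) hg) => v _.
by case: (g v).
Qed.

Lemma computes_leq O k g h : computes O k g -> computes O k h ->
  computes O k (fun v => g v <= h v).
Proof. by move=> hg hh; apply: computes_eq0 (computes_sub hg hh). Qed.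

Lemma computes_eq O k g h : computes O k g -> computes O k h ->
  computes O k (fun v => g v == h v).
Proof.
move=> hg hh.
apply: eq_computes (computes_andb (computes_leq hg hh) (computes_leq hh hg)) => v _.
by rewrite eqn_leq.
Qed.

(** * Coding of finite sets and sequences by numbers *)

Definition bit (a x : nat) : bool := odd (iter a half x).

(** The pairing 2^i (2m + 1). The column of index [i] of a set consists of the [m] whose pair with
    [i] is in the set. *)
Definition pairn (i m : nat) : nat := iter i double m.*2.+1.

Lemma computes_odd O k g : computes O k g -> computes O k (fun v => odd (g v)).
Proof.
apply: (@computes1 _ _ (fun n => odd n)).
apply: (@computes_rec0 _ (fun n => odd n) (fun _ z => 1 - z)).
  by move=> n /=; case: (odd n).
by apply: computes_sub; [exact: computes_const | exact: computes_nth].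
Qed.

Lemma computes_half O k g : computes O k g -> computes O k (fun v => (g v)./2).
Proof.
apply: computes1; apply: (@computes_rec0 _ half (fun n z => odd n + z)).
  by move=> n /=; rewrite uphalf_half.
by apply: computes_add; [apply: computes_odd|]; exact: computes_nth.
Qed.

Lemma computes_bit O k g h : computes O k g -> computes O k h ->
  computes O k (fun v => bit (g v) (h v)).
Proof.
move=> hg hh; apply: computes_odd.
apply: (@computes2 _ _ (fun a x => iter a half x) _ _ _ hg hh).
apply: (@computes_rec _ (fun a x => iter a half x) id (fun _ z _ => z./2)) => //.
  exact: computes_nth.
by apply: computes_half; exact: computes_nth.
Qed.

Lemma computes_double O k g : computes O k g -> computes O k (fun v => (g v).*2).
Proof.
by move=> hg; apply: eq_computes (computes_add hg hg) => v _; rewrite addnn.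
Qed.

Lemma computes_pairn O k g h : computes O k g -> computes O k h ->
  computes O k (fun v => pairn (g v) (h v)).
Proof.
apply: (@computes2 _ _ pairn).
apply: (@computes_rec _ pairn (fun y => y.*2.+1) (fun _ z _ => z.*2)) => //.
  by apply/computes_succ/computes_double; exact: computes_nth.
by apply: computes_double; exact: computes_nth.
Qed.

Lemma leq_pairn i m : m <= pairn i m.
Proof.
elim: i => [|i IH] /=; first by rewrite -addnn -addSn leq_addl.
by apply: leq_trans IH _; rewrite -addnn leq_addl.
Qed.

Lemma pairn_inj i m j n : pairn i m = pairn j n -> i = j /\ m = n.
Proof.
elim: i j => [|i IH] [|j] /=.
- by move=> [/double_inj].
- by move/(congr1 odd); rewrite /= !odd_double.
- by move/(congr1 odd); rewrite /= !odd_double.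
- by move/double_inj/IH => [-> ->].
Qed.

Lemma bitn0 a : bit a 0 = false.
Proof. by rewrite /bit; have -> : iter a half 0 = 0 by elim: a => // a /= ->. Qed.

Lemma bit_leq a x : bit a x -> a <= x.
Proof.
rewrite /bit; elim: a x => // a IH [|x].
  by move=> h; have := bitn0 a.+1; rewrite /bit h.
rewrite iterSr => /IH h; apply: leq_ltn_trans h _; rewrite ltn_half_double.
by rewrite -addnn -[X in X < _]addn0 ltn_add2l.
Qed.

Lemma bits_of_pred (P : nat -> bool) N :
  exists x, forall a, bit a x = (a < N) && P a.
Proof.
elim: N P => [|N IH] P; first by exists 0 => a; rewrite bitn0.
have [x hx] := IH (P \o succn); exists (P 0 + x.*2) => -[|a].
  by rewrite /bit /= oddD odd_double addbF; case: (P 0).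
by rewrite /bit iterSr half_bit_double; exact: hx.
Qed.

(* The [j]-th entry of the finite sequence coded by [v]; the disjunct [m == v] *)
(* only serves to make the search total.                                       *)
Definition entry (v j m : nat) : bool := bit (pairn j m) v || (m == v).

Lemma entry_total v j : exists m, entry v j m.
Proof. by exists v; rewrite /entry eqxx orbT. Qed.

Definition dec (v j : nat) : nat := ex_minn (entry_total v j).

Lemma decE v j y : y = dec v j <-> entry v j y /\ forall m, m < y -> ~ entry v j m.
Proof.
rewrite /dec; case: ex_minnP => n hn min_n; split=> [-> | [hy min_y]].
  by split=> // m lt_m /min_n; rewrite leqNgt lt_m.
case: (ltngtP y n) => // [lt_y|/min_y //].
by move/min_n: hy; rewrite leqNgt lt_y.
Qed.

Lemma dec_surj (f : nat -> nat) k : exists v, forall j, j < k -> dec v j = f j.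
Proof.
pose N := (\max_(j < k) pairn j (f j)).+1.
have [v hv] := bits_of_pred (fun a => `[< exists2 j, j < k & a = pairn j (f j) >]) N.
exists v => j lt_j; apply/esym/decE.
have hb : bit (pairn j (f j)) v.
  rewrite hv; apply/andP; split; last by apply/asboolP; exists j.
  by rewrite ltnS; exact: (@leq_bigmax _ (fun j : 'I_k => pairn j (f j)) (Ordinal lt_j)).
split=> [|m lt_m]; first by rewrite /entry hb.
(* The disjunct [m == v] of [entry] cannot hold below [f j], because [f j <= pairn j (f j) <= v]. *)
case/orP=> [|/eqP e].
  by rewrite hv => /andP[_ /asboolP[i _ /pairn_inj[<- e]]]; rewrite e ltnn in lt_m.
by move: lt_m; rewrite e ltnNge (leq_trans (leq_pairn j _) (bit_leq hb)).
Qed.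

(** * Arithmetical definability *)

Definition scons (x : nat) (e : nat -> nat) (n : nat) : nat :=
  if n is m.+1 then e m else x.

(* First-order definability over the computable relations, for predicates of an *)
(* environment assigning values to de Bruijn variables.                         *)
Inductive arith : ((nat -> nat) -> Prop) -> Prop :=
| arith_base k Q rs : rel_computable_in set0 k Q -> size rs = k ->
    arith (fun e => Q [seq e r | r <- rs])
| arith_not P : arith P -> arith (fun e => ~ P e)
| arith_and P Q : arith P -> arith Q -> arith (fun e => P e /\ Q e)
| arith_ex P : arith P -> arith (fun e => exists x, P (scons x e)).

Definition arith_term (t : (nat -> nat) -> nat) : Prop :=
  arith (fun e => e 0 = t (fun n => e n.+1)).

Lemma eq_arith P Q : (forall e, P e <-> Q e) -> arith P -> arith Q.
Proof. by move=> e; suff -> : P = Q by []; apply/funext => x; apply/propext. Qed.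

Lemma arith_ren P (r : nat -> nat) : arith P -> arith (fun e => P (fun n => e (r n))).
Proof.
move=> h; elim: h r => {P}.
- move=> k Q rs hQ sz r.
  apply: eq_arith (@arith_base k Q (map r rs) hQ _) => [e|]; last by rewrite size_map.
  by rewrite -map_comp.
- by move=> P _ IH r; exact: arith_not (IH r).
- by move=> P Q _ IHP _ IHQ r; exact: arith_and (IHP r) (IHQ r).
- move=> P _ IH r; pose r' n := if n is m.+1 then (r m).+1 else 0.
  apply: eq_arith (arith_ex (IH r')) => e.
  suff E x : (fun n => scons x e (r' n)) = scons x (fun n => e (r n)).
    by split=> -[x hx]; exists x; rewrite E in hx *.
  by apply/funext => -[].
Qed.

Lemma arith_exists (P : (nat -> nat) -> nat -> Prop) :
  arith (fun e => P (fun n => e n.+1) (e 0)) -> arith (fun e => exists x, P e x).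
Proof. exact: arith_ex. Qed.

Lemma arith_forall (P : (nat -> nat) -> nat -> Prop) :
  arith (fun e => P (fun n => e n.+1) (e 0)) -> arith (fun e => forall x, P e x).
Proof.
move=> /arith_not h.
apply: eq_arith (arith_not (@arith_exists (fun e x => ~ P e x) h)) => e.
split=> [h' x|h' [x]]; last by apply; exact: h'.
by apply: contrapT => nP; apply: h'; exists x.
Qed.

Lemma arith_or P Q : arith P -> arith Q -> arith (fun e => P e \/ Q e).
Proof.
move=> hP hQ; apply: eq_arith (arith_not (arith_and (arith_not hP) (arith_not hQ))) => e.
split=> [h|[h|h] []] //; have [|nP] := pselect (P e); first by left.
by right; apply: contrapT => nQ; apply: h.
Qed.

Lemma arith_imp P Q : arith P -> arith Q -> arith (fun e => P e -> Q e).
Proof.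
move=> hP hQ; apply: eq_arith (arith_or (arith_not hP) hQ) => e.
split=> [[nP|] //|h]; have [/h|] := pselect (P e); by [right|left].
Qed.

Lemma arith_iff P Q : arith P -> arith Q -> arith (fun e => P e <-> Q e).
Proof. by move=> hP hQ; apply: arith_and; apply: arith_imp. Qed.

Lemma arith_computes2 (R : nat -> nat -> bool) :
  computes (chi set0) 2 (fun v => R (nth 0 v 0) (nth 0 v 1)) ->
  arith (fun e => R (e 0) (e 1)).
Proof.
move=> hR; apply: (@arith_base 2 (fun v => R (nth 0 v 0) (nth 0 v 1)) [:: 0; 1]) => //.
by apply: eq_computes hR => v _; rewrite asboolb.
Qed.

Lemma arith_computes3 (R : nat -> nat -> nat -> bool) :
  computes (chi set0) 3 (fun v => R (nth 0 v 0) (nth 0 v 1) (nth 0 v 2)) ->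
  arith (fun e => R (e 0) (e 1) (e 2)).
Proof.
move=> hR.
apply: (@arith_base 3 (fun v => R (nth 0 v 0) (nth 0 v 1) (nth 0 v 2)) [:: 0; 1; 2]) => //.
by apply: eq_computes hR => v _; rewrite asboolb.
Qed.

Lemma arith_var i : arith_term (fun e => e i).
Proof.
apply: (@arith_ren (fun e => e 0 = e 1) (fun n => if n is 0 then 0 else i.+1)).
apply: eq_arith (@arith_computes2 (fun x y => x == y) _) => [e|]; first by split=> /eqP.
by apply: computes_eq; exact: computes_nth.
Qed.

Lemma arith_const c : arith_term (fun=> c).
Proof.
apply: eq_arith (@arith_computes2 (fun x _ => x == c) _) => [e|]; first by split=> /eqP.
by apply: computes_eq; [exact: computes_nth | exact: computes_const].
Qed.

Lemma arith_term_ren t (r : nat -> nat) :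
  arith_term t -> arith_term (fun e => t (fun n => e (r n))).
Proof. exact: (@arith_ren _ (fun n => if n is m.+1 then (r m).+1 else 0)). Qed.

Lemma arith_shift t : arith_term t -> arith_term (fun e => t (fun n => e n.+1)).
Proof. exact: arith_term_ren. Qed.

(** A term is known only through its graph, so substituting it costs an existential quantifier. *)
Lemma arith_app1 (R : nat -> Prop) t :
  arith (fun e => R (e 0)) -> arith_term t -> arith (fun e => R (t e)).
Proof.
move=> hR ht; apply: eq_arith (arith_exists (P := fun e x => x = t e /\ R x) _).
  by move=> e; split=> [[x [->]]|]; last by exists (t e).
exact: arith_and.
Qed.

Lemma arith_app2 (R : nat -> nat -> Prop) t u :
  arith (fun e => R (e 0) (e 1)) -> arith_term t -> arith_term u ->
  arith (fun e => R (t e) (u e)).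
Proof.
move=> hR ht hu; apply: eq_arith (arith_exists (P := fun e x => x = t e /\
   exists y, y = u e /\ R x y) _).
  by move=> e; split=> [[x [-> [y [->]]]]|]; last by exists (t e); split=> //; exists (u e).
apply: arith_and => //; apply: arith_exists; apply: arith_and; first exact: arith_shift hu.
exact: (arith_ren (fun n => if n is 0 then 1 else 0) hR).
Qed.

Lemma arith_app3 (R : nat -> nat -> nat -> Prop) t u w :
  arith (fun e => R (e 0) (e 1) (e 2)) -> arith_term t -> arith_term u -> arith_term w ->
  arith (fun e => R (t e) (u e) (w e)).
Proof.
move=> hR ht hu hw; apply: eq_arith (arith_exists (P := fun e x => x = t e /\
   exists y, y = u e /\ exists z, z = w e /\ R x y z) _).
  move=> e; split=> [[x [-> [y [-> [z [->]]]]]] //|h].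
  by exists (t e); split=> //; exists (u e); split=> //; exists (w e).
apply: arith_and => //; apply: arith_exists; apply: arith_and; first exact: arith_shift hu.
apply: arith_exists; apply: arith_and; first exact: arith_shift (arith_shift hw).
exact: (arith_ren (fun n => if n is n'.+1 then if n' is 0 then 1 else 0 else 2) hR).
Qed.

Lemma arith_fun1 (f : nat -> nat) t :
  arith_term (fun e => f (e 0)) -> arith_term t -> arith_term (fun e => f (t e)).
Proof.
move=> hf ht; apply: (@arith_app2 (fun y x => y = f x)) => //.
  exact: (@arith_var 0).
exact: arith_shift.
Qed.

Lemma arith_fun2 (f : nat -> nat -> nat) t u :
  arith_term (fun e => f (e 0) (e 1)) -> arith_term t -> arith_term u ->
  arith_term (fun e => f (t e) (u e)).
Proof.
move=> hf ht hu; apply: (@arith_app3 (fun z x y => z = f x y)) => //.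
- exact: (@arith_var 0).
- exact: arith_shift.
- exact: arith_shift.
Qed.

Lemma arith_eq t u : arith_term t -> arith_term u -> arith (fun e => t e = u e).
Proof. by apply: (@arith_app2 (fun x y => x = y)); exact: (@arith_var 0). Qed.

Lemma arith_leq t u : arith_term t -> arith_term u -> arith (fun e => t e <= u e).
Proof.
apply: (@arith_app2 (fun x y => x <= y)); apply: arith_computes2.
by apply: computes_leq; exact: computes_nth.
Qed.

Lemma arith_bit t u : arith_term t -> arith_term u -> arith (fun e => bit (t e) (u e)).
Proof.
apply: (@arith_app2 bit); apply: arith_computes2.
by apply: computes_bit; exact: computes_nth.
Qed.

Lemma arith_succ t : arith_term t -> arith_term (fun e => (t e).+1).
Proof.
apply: (@arith_fun1 succn).
apply: eq_arith (@arith_computes2 (fun x y => x == y.+1) _) => [e|]; first by split=> /eqP.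
by apply: computes_eq; [|apply: computes_succ]; exact: computes_nth.
Qed.

Lemma arith_pairn t u : arith_term t -> arith_term u ->
  arith_term (fun e => pairn (t e) (u e)).
Proof.
apply: (@arith_fun2 pairn).
apply: eq_arith (@arith_computes3 (fun x y z => x == pairn y z) _) => [e|].
  by split=> /eqP.
by apply: computes_eq; [|apply: computes_pairn]; exact: computes_nth.
Qed.

Lemma arith_entry t u w : arith_term t -> arith_term u -> arith_term w ->
  arith (fun e => entry (t e) (u e) (w e)).
Proof.
move=> ht hu hw; apply: (@eq_arith (fun e => bit (pairn (u e) (w e)) (t e) \/ w e = t e)).
  by move=> e; rewrite /entry; split=> [[->|->]|/orP[->|/eqP ->]];
    rewrite ?eqxx ?orbT; auto.
by apply: arith_or; [apply: arith_bit => //; apply: arith_pairn | apply: arith_eq].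
Qed.

Lemma arith_dec t u : arith_term t -> arith_term u ->
  arith_term (fun e => dec (t e) (u e)).
Proof.
apply: (@arith_fun2 dec).
apply: (@eq_arith (fun e => entry (e 1) (e 2) (e 0) /\
    forall m, m < e 0 -> ~ entry (e 1) (e 2) m)).
  by move=> e; rewrite decE.
apply: arith_and; first by apply: arith_entry; exact: arith_var.
apply: arith_forall; apply: arith_imp.
  by apply: arith_leq; [apply: arith_succ|]; exact: arith_var.
by apply: arith_not; apply: arith_entry; exact: arith_var.
Qed.

(** Definability is not uniform: a fixed proposition is replaced by a trivially true or a trivially
    false formula according to its truth value. *)
Lemma arith_prop (P : Prop) : arith (fun=> P).
Proof.
have [p|np] := pselect P.
  apply: (@eq_arith (fun e => e 0 = e 0)) => //; apply: arith_eq; exact: arith_var.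
apply: (@eq_arith (fun e => ~ e 0 = e 0)) => //.
by apply: arith_not; apply: arith_eq; exact: arith_var.
Qed.

Lemma arith_forall_ltn k (P : nat -> (nat -> nat) -> Prop) :
  (forall i, i < k -> arith (P i)) -> arith (fun e => forall i, i < k -> P i e).
Proof.
elim: k => [|k IH] h; first by apply: (@eq_arith (fun=> True)) => //; exact: arith_prop.
apply: eq_arith (arith_and (h k (ltnSn k)) (IH (fun i lt_i => h i (ltnW lt_i)))) => e.
split=> [[hk hlt] i|h']; last by split=> [|i lt_i]; apply: h' => //; exact: ltnW.
by rewrite ltnS leq_eqVlt => /orP[/eqP -> //|]; exact: hlt.
Qed.

(** The definitions of the [P i] may be unrelated; since only finitely many are involved, a finite
    conjunction over [i < k] makes the index a variable. *)
Lemma arith_slices k (P : nat -> (nat -> nat) -> Prop) :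
  (forall i, i < k -> arith (P i)) ->
  arith (fun e => e 0 < k /\ P (e 0) (fun n => e n.+1)).
Proof.
move=> h; apply: (@eq_arith (fun e => e 0 < k /\
   forall i, i < k -> e 0 = i -> P i (fun n => e n.+1))).
  move=> e; split=> -[lt_k he]; split=> //; first exact: he.
  by move=> i _ <-.
apply: arith_and.
  by apply: arith_leq; [apply: arith_succ; exact: arith_var | exact: arith_const].
apply: arith_forall_ltn => i lt_i; apply: arith_imp.
  by apply: arith_eq; [exact: arith_var | exact: arith_const].
exact: arith_ren (h i lt_i).
Qed.

(** Reads definability off the shape of the formula. Opaque predicates are settled by hypotheses of
    the context, and what does not mention the environment by [arith_prop]. *)
Ltac arith_step :=
  cbv beta;
  lazymatch goal with
  | |- arith_term (fun e => e _) => apply: arith_var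
  | |- arith_term (fun e => (@?t e).+1) => apply: arith_succ
  | |- arith_term (fun e => pairn (@?t e) (@?u e)) => apply: arith_pairn
  | |- arith_term (fun e => dec (@?t e) (@?u e)) => apply: arith_dec
  | |- arith_term (fun e => ?t (fun n => e (@?r n))) => apply: (@arith_term_ren t r)
  | |- arith_term (fun=> _) => apply: arith_const
  | |- arith_term _ => assumption
  | |- arith (fun e => @?P e /\ @?Q e) => apply: arith_and
  | |- arith (fun e => @?P e \/ @?Q e) => apply: arith_or
  | |- arith (fun e => @?P e <-> @?Q e) => apply: arith_iff
  | |- arith (fun e => ~ @?P e) => apply: arith_not
  | |- arith (fun e => forall x : nat, @?P e x) => apply: arith_forall
  | |- arith (fun e => @?P e -> @?Q e) => apply: arith_imp
  | |- arith (fun e => exists x : nat, @?P e x) => apply: arith_exists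
  | |- arith (fun e => @?t e = @?u e :> nat) => apply: arith_eq
  | |- arith (fun e => is_true (@?t e <= @?u e)) => apply: arith_leq
  | |- arith (fun e => is_true (bit (@?t e) (@?u e))) => apply: arith_bit
  | H : arith (fun e => ?R (e 0)) |- arith (fun e => ?R (@?t e)) =>
      apply: (arith_app1 H)
  | H : arith (fun e => ?R (e 0) (e 1)) |- arith (fun e => ?R (@?t e) (@?u e)) =>
      apply: (arith_app2 H)
  | H : arith (fun e => ?R (e 0) (e 1) (e 2)) |-
      arith (fun e => ?R (@?t e) (@?u e) (@?w e)) => apply: (arith_app3 H)
  | |- arith (fun=> _) => apply: arith_prop
  end.
Ltac arith_auto := repeat arith_step.

(** * Prenex normal form *)

Lemma alternating_congr ex n P Q v w :
  (forall ys, size ys = n -> (P (v ++ ys) <-> Q (w ++ ys))) ->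
  alternating ex n P v <-> alternating ex n Q w.
Proof.
elim: n ex v w => [|n IH] ex v w h; first by have := h [::] erefl; rewrite !cats0.
have E y ex' : alternating ex' n P (rcons v y) <-> alternating ex' n Q (rcons w y).
  by apply: IH => ys sz; rewrite !cat_rcons; apply: h => /=; rewrite sz.
case: ex => /=; first by split=> -[y /E]; exists y.
by split=> h' y; apply/E.
Qed.

Lemma alternating_not ex n P v :
  ~ alternating ex n P v <-> alternating (~~ ex) n (fun w => ~ P w) v.
Proof.
elim: n ex v => [|n IH] [] v //=.
  by rewrite -forallNP; split=> h y; have := h y; rewrite (IH false).
by rewrite -existsNP; split=> -[y hy]; exists y; move: hy; rewrite (IH true).
Qed.

Lemma alternating_and ex n (R : Prop) P v :
  R /\ alternating ex n P v <-> alternating ex n (fun w => R /\ P w) v.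
Proof.
elim: n ex v => [|n IH] [] v //=.
  split=> [[r [y hy]]|[y /IH[r hy]]]; first by exists y; apply/IH.
  by split=> //; exists y.
split=> [[r h] y|h]; first by apply/IH.
by split=> [|y]; [have /IH[] := h 0 | have /IH[] := h y].
Qed.

Lemma alternating_add ex m n P v :
  alternating ex (m + n) P v <->
  alternating ex m (alternating (ex (+) odd m) n P) v.
Proof.
elim: m ex v => [|m IH] ex v; first by rewrite /= addbF.
have -> : ex (+) odd m.+1 = ~~ ex (+) odd m by rewrite /= addbN addNb.
case: ex => /=; first by split=> -[y /IH]; exists y.
by split=> h y; apply/IH.
Qed.

Lemma rel_computable_ren O k n Q rs : rel_computable_in O n Q -> size rs = n ->
  rel_computable_in O k (fun v => Q [seq nth 0 v r | r <- rs]).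
Proof.
move=> hQ sz; have := @computes_comp (chi O) k (fun v => `[< Q v >])
  [seq (fun v => nth 0 v r) | r <- rs].
rewrite size_map sz => /(_ hQ) h; apply: eq_computes (h _) => [v _|i lt_i].
  by rewrite -map_comp.
by rewrite (nth_map 0) ?sz //; exact: computes_nth.
Qed.

Lemma rel_computable_not O k Q : rel_computable_in O k Q ->
  rel_computable_in O k (fun v => ~ Q v).
Proof.
by move/computes_negb; apply: eq_computes => v _; rewrite asbool_neg.
Qed.

Lemma rel_computable_and O k Q R : rel_computable_in O k Q ->
  rel_computable_in O k R -> rel_computable_in O k (fun v => Q v /\ R v).
Proof.
move=> hQ hR; apply: eq_computes (computes_andb hQ hR) => v _.
by rewrite asbool_and.
Qed.

(** Both types of leading quantifier are demanded, so that a prefix can always be continued by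
    another one without breaking the alternation. *)
Definition prenex (K : nat) (P : (nat -> nat) -> Prop) : Prop :=
  forall ex, exists n R, rel_computable_in set0 (K + n) R /\
    forall v, size v = K -> (P (nth 0 v) <-> alternating ex n R v).

(* A dummy quantifier in front changes the type of the leading quantifier. *)
Lemma prenexW K P ex n R : rel_computable_in set0 (K + n) R ->
  (forall v, size v = K -> (P (nth 0 v) <-> alternating ex n R v)) -> prenex K P.
Proof.
move=> hR h ex'; have [->|ne] := eqVneq ex' ex; first by exists n, R.
have -> : ex' = ~~ ex by case: ex ex' ne {h} => [] [].
pose rs := iota 0 K ++ iota K.+1 n.
exists n.+1, (fun w => R [seq nth 0 w r | r <- rs]); split.
  by apply: rel_computable_ren hR _; rewrite size_cat !size_iota.
move=> v sz; rewrite h //.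
have E y : alternating ex n R v <->
    alternating ex n (fun w => R [seq nth 0 w r | r <- rs]) (rcons v y).
  apply: alternating_congr => ys sz'; rewrite cat_rcons map_cat.
  suff [-> ->] : [seq nth 0 (v ++ y :: ys) r | r <- iota 0 K] = v /\
      [seq nth 0 (v ++ y :: ys) r | r <- iota K.+1 n] = ys by [].
  split; apply: (@eq_from_nth _ 0); rewrite ?size_map ?size_iota // => i lt_i.
    by rewrite (nth_map 0) ?size_iota // nth_iota // nth_cat sz lt_i.
  rewrite (nth_map 0) ?size_iota // nth_iota // nth_cat sz ltnNge.
  by rewrite addSnnS leq_addr /= addKn.
case: ex E h {ne} => E h /=; last by split=> [/(E 0)|[y /E]] //; exists 0.
by split=> [/E|h'] //; apply/(E 0).
Qed.

Lemma arith_prenex P : arith P -> exists K0, forall K, K0 <= K -> prenex K P.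
Proof.
elim=> {P}.
- move=> k Q rs hQ sz; exists 0 => K _.
  apply: (@prenexW _ _ true 0 (fun v => Q [seq nth 0 v r | r <- rs])) => //.
  exact: rel_computable_ren hQ sz.
- move=> P _ [K0 IH]; exists K0 => K /IH /(_ true) [n [R [hR h]]].
  apply: (@prenexW _ _ false n (fun w => ~ R w)); first exact: rel_computable_not.
  by move=> v sz; rewrite -(alternating_not true) h.
- move=> P Q _ [K1 IH1] _ [K2 IH2]; exists (maxn K1 K2) => K.
  rewrite geq_max => /andP[/IH1 h1 /IH2 h2].
  (* [true (+) odd n] is the type of the quantifier due after [n] alternations, so the second prefix
     can follow the first. The matrices then read [v ++ ys] and [v ++ zs] from [v ++ ys ++ zs]. *)
  have [n [R [hR h]]] := h1 true; have [m [S [hS h']]] := h2 (true (+) odd n).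
  pose rs := iota 0 (K + n); pose ss := iota 0 K ++ iota (K + n) m.
  apply: (@prenexW _ _ true (n + m) (fun w => R [seq nth 0 w r | r <- rs] /\
     S [seq nth 0 w r | r <- ss])).
    apply: rel_computable_and; apply: rel_computable_ren; try eassumption.
      by rewrite size_iota.
    by rewrite size_cat !size_iota.
  move=> v sz; rewrite alternating_add h // h' //.
  set T := alternating (true (+) odd n) m S v.
  rewrite (_ : _ /\ _ <-> T /\ alternating true n R v); last by split=> -[].
  rewrite alternating_and; apply: alternating_congr => ys sz_ys.
  rewrite (_ : _ /\ _ <-> R (v ++ ys) /\ T); last by split=> -[].
  rewrite alternating_and; apply: alternating_congr => zs sz_zs.
  suff [-> ->] : [seq nth 0 ((v ++ ys) ++ zs) r | r <- rs] = v ++ ys /\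
     [seq nth 0 ((v ++ ys) ++ zs) r | r <- ss] = v ++ zs by [].
  split; apply: (@eq_from_nth _ 0);
    rewrite ?size_map ?size_cat ?size_iota ?sz ?sz_ys ?sz_zs // => i lt_i.
    by rewrite (nth_map 0) ?size_iota // nth_iota // nth_cat size_cat sz sz_ys lt_i.
  rewrite (nth_map 0) ?size_cat ?size_iota // [RHS]nth_cat sz.
  rewrite /ss [nth 0 (iota _ _ ++ _) _]nth_cat size_iota.
  have [lt_iK|le_Ki] := ltnP i K.
    by rewrite nth_iota // -catA nth_cat sz lt_iK.
  rewrite nth_iota; last by rewrite ltn_subLR.
  by rewrite nth_cat size_cat sz sz_ys ltnNge leq_addr /= addKn.
- move=> P _ [K0 IH]; exists K0 => K le_K.
  have [n [R [hR h]]] := IH _ (leqW le_K) false.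
  (* [scons] puts the new value in front while [alternating] appends it at position [K]; [rs] moves
     it back to the front. *)
  pose rs := K :: iota 0 K ++ iota K.+1 n.
  apply: (@prenexW _ _ true n.+1 (fun w => R [seq nth 0 w r | r <- rs])).
    by apply: rel_computable_ren hR _; rewrite /= size_cat !size_iota.
  move=> v sz /=.
  suff E x : P (scons x (nth 0 v)) <->
      alternating false n (fun w => R [seq nth 0 w r | r <- rs]) (rcons v x).
    by split=> -[x /E]; exists x.
  have -> : scons x (nth 0 v) = nth 0 (x :: v) by apply/funext => -[].
  rewrite h /= ?sz //; apply: alternating_congr => ys sz_ys.
  rewrite cat_rcons /= map_cat nth_cat sz ltnn subnn /=.
  suff [-> ->] : [seq nth 0 (v ++ x :: ys) r | r <- iota 0 K] = v /\
      [seq nth 0 (v ++ x :: ys) r | r <- iota K.+1 n] = ys by [].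
  split; apply: (@eq_from_nth _ 0); rewrite ?size_map ?size_iota // => i lt_i.
    by rewrite (nth_map 0) ?size_iota // nth_iota // nth_cat sz lt_i.
  rewrite (nth_map 0) ?size_iota // nth_iota // nth_cat sz ltnNge.
  by rewrite addSnnS leq_addr /= addKn.
Qed.

Lemma arith_arithmetical (X : set nat) : arith (fun e => X (e 0)) -> arithmetical X.
Proof.
case/arith_prenex => K0 /(_ K0.+1 (leqnSn _)) /(_ true) [n [R [hR h]]].
exists n; left.
(* Out-of-range projections read 0, which supplies the K0 unused arguments. *)
pose rs := 0 :: nseq K0 n.+1 ++ iota 1 n.
exists (fun w => R [seq nth 0 w r | r <- rs]).
  by apply: rel_computable_ren hR _; rewrite /= size_cat size_nseq size_iota.
move=> x; have -> : X x <-> alternating true n R (x :: nseq K0 0).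
  by rewrite -h //= size_nseq.
apply: alternating_congr => ys sz; rewrite /= map_cat map_nseq /=.
rewrite nth_default ?sz //.
suff -> : [seq nth 0 (x :: ys) r | r <- iota 1 n] = ys by [].
apply: (@eq_from_nth _ 0); rewrite ?size_map ?size_iota // => i lt_i.
by rewrite (nth_map 0) ?size_iota // nth_iota.
Qed.

(** * Arithmetical separation of ill-founded parts *)

Definition bits (x a : nat) : nat := bit a x.

(** The recursion is unwound in the manner of Gödel: [w] codes the sequence of all intermediate
    values. *)
Lemma eval_precE O f g n v y : eval O (Prec f g) (n :: v) y <->
  exists w, [/\ eval O f v (dec w 0), dec w n = y &
    forall i, i < n -> eval O g [:: i, dec w i & v] (dec w i.+1)].
Proof.
split=> [h|[w [h0 <- hS]]]; last first.
  elim: n hS => [|n IH] hS; first exact: eval_prec0.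
  apply: eval_precS (hS n (ltnSn n)); apply: IH => i lt_i; exact: hS (ltnW lt_i).
suff [s [h0 <- hS]] : exists s : nat -> nat, [/\ eval O f v (s 0), s n = y &
    forall i, i < n -> eval O g [:: i, s i & v] (s i.+1)].
  have [w hw] := dec_surj s n.+1; exists w; rewrite !hw //; split=> // i lt_i.
  by rewrite !hw //; [exact: hS | exact: ltnW].
elim: n y h => [|n IH] y /eval_prec_inv [m [u [[<- <-]]]].
  by move=> h; exists (fun=> y).
case=> z /IH [s [h0 hn hS]] h; exists (fun i => if i == n.+1 then y else s i).
split=> //; first by rewrite eqxx.
move=> i; rewrite ltnS eqSS => le_i; rewrite ltn_eqF //.
case: eqVneq le_i => [-> _|ne le_i]; first by rewrite hn.
by apply: hS; rewrite ltn_neqAle ne.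
Qed.

Lemma eval_muE O f v n : eval O (Mu f) v n <->
  (forall m, m < n -> exists w, eval O f (m :: v) w.+1) /\ eval O f (n :: v) 0.
Proof.
split=> [/eval_mu_inv //|[h1 h2]].
have /choice [w hw] m : exists w, m < n -> eval O f (m :: v) w.+1.
  by have [/h1 [w]|] := boolP (m < n); [exists w | exists 0].
exact: eval_mu hw h2.
Qed.

Lemma nth_map_env (ts : seq ((nat -> nat) -> nat)) e i :
  nth 0 [seq t e | t <- ts] i = nth (fun=> 0) ts i e.
Proof. by elim: ts i => [|t ts IH] [|i] /=. Qed.

Definition shift_terms (ts : seq ((nat -> nat) -> nat)) :=
  [seq (fun e => t (fun n => e n.+1)) | t <- ts].

Lemma arith_shift_terms ts : (forall i, arith_term (nth (fun=> 0) ts i)) ->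
  forall i, arith_term (nth (fun=> 0) (shift_terms ts) i).
Proof.
elim: ts => [|t ts IH] h [|i] /=; try exact: arith_const.
  exact: arith_shift (h 0).
by apply: IH => j; exact: (h j.+1).
Qed.

Lemma shift_termsE ts e : [seq t e | t <- shift_terms ts] =
  [seq t (fun n => e n.+1) | t <- ts].
Proof. by rewrite /shift_terms -map_comp. Qed.

(** The oracle is a finite set coded by a number, so it can be quantified over. Oracle, arguments
    and value are arbitrary terms, which lets the induction hypotheses be used beneath new
    quantifiers. *)
Lemma arith_eval c : forall tr ts ty, arith_term tr ->
  (forall i, arith_term (nth (fun=> 0) ts i)) -> arith_term ty ->
  arith (fun e => eval (bits (tr e)) c [seq t e | t <- ts] (ty e)).
Proof.
elim/code_nested_ind: c => [||i||f gs IHf IHg|f g IHf IHg|f IHf] tr ts ty htr hts hty.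
- apply: (@eq_arith (fun e => ty e = 0)); last by arith_auto.
  by move=> e; split=> [->|h]; [constructor | inversion h].
- apply: (@eq_arith (fun e => ty e = (nth (fun=> 0) ts 0 e).+1)).
    move=> e; rewrite -nth_map_env; split=> [->|h]; by [constructor | inversion h].
  by apply: arith_eq => //; apply: arith_succ; exact: (hts 0).
- apply: (@eq_arith (fun e => ty e = nth (fun=> 0) ts i e)).
    move=> e; rewrite -nth_map_env; split=> [->|h]; by [constructor | inversion h].
  by apply: arith_eq => //; exact: hts.
- apply: (@eq_arith (fun e => (bit (nth (fun=> 0) ts 0 e) (tr e) /\ ty e = 1) \/
     (~ bit (nth (fun=> 0) ts 0 e) (tr e) /\ ty e = 0))).
    move=> e; rewrite -nth_map_env; set a := nth 0 _ 0.
    have -> : eval (bits (tr e)) Query [seq t e | t <- ts] (ty e) <->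
        ty e = bit a (tr e).
      by split=> [h|->]; [inversion h | exact: eval_query].
    by case: bit; split=> [[][]|->] //; [left | right].
  have h0 := hts 0; arith_auto.
- apply: (@eq_arith (fun e => exists w,
     (forall i, i < size gs ->
        eval (bits (tr e)) (nth Zero gs i) [seq t e | t <- ts] (dec w i)) /\
     eval (bits (tr e)) f [seq t e | t <- mkseq (fun i _ => dec w i) (size gs)] (ty e))).
    move=> e; have E w : [seq t e | t <- mkseq (fun i _ => dec w i) (size gs)] =
        mkseq (dec w) (size gs) by rewrite /mkseq -map_comp.
    split=> [[w [hg]]|/eval_comp_inv [ws [sz hg hf]]].
      rewrite E => hf; apply: eval_comp hf; first by rewrite size_mkseq.
      by move=> i lt_i; rewrite nth_mkseq //; exact: hg.
    have [w hw] := dec_surj (nth 0 ws) (size gs); exists w; split.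
      by move=> i lt_i; rewrite hw //; exact: hg.
    rewrite E; have -> : mkseq (dec w) (size gs) = ws; last by [].
    apply: (@eq_from_nth _ 0); rewrite size_mkseq // => i lt_i.
    by rewrite nth_mkseq // hw.
  apply: arith_exists; apply: arith_and.
    apply: arith_forall_ltn => i lt_i.
    apply: eq_arith (IHg i lt_i _ (shift_terms ts) (fun e => dec (e 0) i)
      (arith_shift htr) (arith_shift_terms hts) _) => [e|]; first by rewrite shift_termsE.
    by arith_auto.
  apply: eq_arith (IHf _ (mkseq (fun i e => dec (e 0) i) (size gs)) _
    (arith_shift htr) _ (arith_shift hty)) => [e|i].
  + by rewrite /mkseq -!map_comp.
  + have [lt_i|le_i] := ltnP i (size gs); last first.
      by rewrite nth_default ?size_mkseq //; exact: arith_const.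
    by rewrite nth_mkseq //; arith_auto.
- case: ts hts => [|tn ts] hts.
    apply: (@eq_arith (fun=> False)); last exact: arith_prop.
    by move=> e; split=> // /eval_prec_inv [n [w []]].
  have htn := hts 0; have {}hts i := hts i.+1.
  apply: (@eq_arith (fun e => exists w,
    (eval (bits (tr e)) f [seq t e | t <- ts] (dec w 0) /\ dec w (tn e) = ty e) /\
    forall i, i < tn e ->
      eval (bits (tr e)) g [:: i, dec w i & [seq t e | t <- ts]] (dec w i.+1))).
    move=> e /=; rewrite eval_precE.
    by split=> [[w [[]]]|[w []]]; exists w.
  apply: arith_exists; apply: arith_and; first apply: arith_and.
  + apply: eq_arith (IHf _ (shift_terms ts) (fun e => dec (e 0) 0) (arith_shift htr)
      (arith_shift_terms hts) _) => [e|]; first by rewrite shift_termsE.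
    by arith_auto.
  + by arith_auto.
  apply: arith_forall; apply: arith_imp; first by arith_auto.
  apply: eq_arith (IHg _ [:: (fun e => e 0), (fun e => dec (e 1) (e 0)) &
    shift_terms (shift_terms ts)] (fun e => dec (e 1) (e 0).+1)
    (arith_shift (arith_shift htr)) _ _) => [e|[|[|i]]|] /=; try by arith_auto.
    by rewrite !shift_termsE.
  exact: arith_shift_terms (arith_shift_terms hts) i.
- apply: (@eq_arith (fun e => (forall m, m < ty e ->
      exists w, eval (bits (tr e)) f (m :: [seq t e | t <- ts]) w.+1) /\
      eval (bits (tr e)) f (ty e :: [seq t e | t <- ts]) 0)).
    by move=> e; rewrite eval_muE.
  apply: arith_and; last first.
    apply: (IHf _ (ty :: ts) (fun=> 0)) => // [[|i] //|]; last exact: arith_const.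
    exact: hts.
  apply: arith_forall; apply: arith_imp; first by arith_auto.
  apply: arith_exists.
  apply: eq_arith (IHf _ ((fun e => e 1) :: shift_terms (shift_terms ts))
    (fun e => (e 0).+1) (arith_shift (arith_shift htr)) _ _) => [e|[|i]|] /=;
    try by arith_auto.
    by rewrite !shift_termsE.
  exact: arith_shift_terms (arith_shift_terms hts) i.
Qed.

(** * Leftmost paths and separation *)

Definition agree (n x y : nat) : Prop := forall a, a < n -> (bit a x <-> bit a y).

Lemma agreeW m n x y : m <= n -> agree n x y -> agree m x y.
Proof. by move=> le_mn h a lt_a; apply: h; exact: leq_trans lt_a le_mn. Qed.

Lemma agree_sym n x y : agree n x y -> agree n y x.
Proof. by move=> h a /h ->. Qed.

Lemma agree_trans n x y z : agree n x y -> agree n y z -> agree n x z.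
Proof. by move=> h1 h2 a lt_a; rewrite (h1 a lt_a); exact: h2. Qed.

Lemma agree_set n x (P : Prop) : exists y, agree n y x /\ (bit n y <-> P).
Proof.
have [y hy] := bits_of_pred (fun a => if a == n then `[< P >] else bit a x) n.+1.
exists y; split=> [a lt_a|]; last by rewrite hy eqxx ltnSn; split=> /asboolP.
by rewrite hy (ltn_eqF lt_a) ltnW.
Qed.

Lemma agreeS n x y : agree n x y -> (bit n x <-> bit n y) -> agree n.+1 x y.
Proof. by move=> h hn a; rewrite ltnS leq_eqVlt => /orP[/eqP -> //|]; exact: h. Qed.

(* The witness is the leftmost infinite path of the tree [Con b]. *)
Lemma arith_path (Con : nat -> nat -> nat -> Prop) :
  arith (fun e => Con (e 0) (e 1) (e 2)) ->
  (forall b x y n, agree n x y -> Con b x n -> Con b y n) ->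
  (forall b x m n, m <= n -> Con b x n -> Con b x m) ->
  exists u : nat -> nat -> Prop, arith (fun e => u (e 0) (e 1)) /\
    forall b, (forall n, exists x, Con b x n) ->
    forall n x, (forall a, a < n -> (bit a x <-> u b a)) -> Con b x n.
Proof.
move=> hCon ext mono.
(* [good]: the string extends to arbitrarily long nodes of the tree. [zero]: it stays good with next
   bit 0. [greedy]: bit 0 is taken whenever possible. All quantifiers range over numbers, so the
   path is arithmetical. *)
pose good b x n := forall m, exists y, agree n y x /\ Con b y m.
pose zero b x i := exists y, agree i y x /\ ~ bit i y /\ good b y i.+1.
pose greedy b x n := forall i, i < n -> (bit i x <-> ~ zero b x i).
have good_agree b x y n : agree n x y -> good b x n -> good b y n.
  move=> e h m; have [z [hz hc]] := h m; exists z; split=> //; exact: agree_trans hz e.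
have zero_agree b x y n : agree n x y -> zero b x n -> zero b y n.
  by move=> e [z [hz hg]]; exists z; split=> //; exact: agree_trans hz e.
have greedyW b x m n : m <= n -> greedy b x n -> greedy b x m.
  by move=> le_mn h i lt_i; apply: h; exact: leq_trans lt_i le_mn.
have greedy_uniq b x y n : greedy b x n -> greedy b y n -> agree n x y.
  elim: n => // n IH hx hy.
  have e := IH (greedyW _ _ _ _ (leqnSn n) hx) (greedyW _ _ _ _ (leqnSn n) hy).
  apply: agreeS => //; rewrite hx // hy //.
  by split=> h z; apply: h; apply: zero_agree z => //; exact: agree_sym.
have greedy_ex b n : exists x, greedy b x n.
  elim: n => [|n [x hx]]; first by exists 0.
  have [y [hy hn]] := agree_set n x (~ zero b x n); exists y => i.
  rewrite ltnS leq_eqVlt => /orP[/eqP ->|lt_i].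
    rewrite hn; split=> h z; apply: h; apply: zero_agree z => //; exact: agree_sym.
  rewrite (hy i lt_i) (hx i lt_i); have e := agreeW (ltnW lt_i) hy.
  by split=> h z; apply: h; apply: zero_agree z => //; exact: agree_sym.
exists (fun b a => exists x, greedy b x a.+1 /\ bit a x); split.
  by rewrite /greedy /zero /good /agree; arith_auto.
move=> b inf n x hx; have [y hy] := greedy_ex b n.
have eyx : agree n y x.
  move=> a lt_a; rewrite hx //; have h := greedyW _ _ _ _ lt_a hy.
  split=> [ya|[z [hz za]]]; first by exists y.
  by apply/(greedy_uniq _ _ _ _ h hz a (ltnSn a)).
suff /(_ n) [z [hz hc]] : good b y n.
  by apply: ext hc; exact: agree_trans hz eyx.
elim: n {x hx eyx} hy => [|n IH] hy; first by move=> m; have [z hz] := inf m; exists z.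
have {}IH := IH (greedyW _ _ _ _ (leqnSn n) hy).
have [[z [ezy [nz gz]]]|nzero] := pselect (zero b y n).
  apply: (good_agree _ _ _ _ _ gz); apply: agreeS => //.
  by split=> [/nz|/(hy n (ltnSn n)) h] //; case: h; exists z.
(* If neither child is good, [m1] and [m2] bound the nodes above them; but the good parent has a
   node of length [maxn m1 m2], which passes through one of the two. *)
apply: contrapT => ngood.
have [m1 hm1] : exists m, forall z, agree n.+1 z y -> ~ Con b z m.
  apply: contrapT => h; apply: ngood => m; apply: contrapT => h'; apply: h; exists m => z ez hz.
  by apply: h'; exists z.
have [y' [ey' ny']] := agree_set n y False.
have [m2 hm2] : exists m, forall z, agree n.+1 z y' -> ~ Con b z m.
  apply: contrapT => h; apply: nzero; exists y'; split=> //; split; first by case: ny'.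
  by move=> m; apply: contrapT => h'; apply: h; exists m => z ez hz; apply: h'; exists z.
have [z [ez hz]] := IH (maxn m1 m2).
have [nz|nz] := boolP (bit n z).
  apply: (hm1 z); last exact: mono (leq_maxl _ _) hz.
  by apply: agreeS => //; rewrite nz hy //; split.
apply: (hm2 z); last exact: mono (leq_maxr _ _) hz.
apply: agreeS; first exact: agree_trans ez (agree_sym ey').
by rewrite (negbTE nz); split=> // /ny'.
Qed.

(* [A] separates the tuples of points of the ill-founded parts [I j] from the    *)
(* tuples of points outside. The tuples of sets [U] such that                    *)
(*   (i)  below each tuple of points of [U] there is a tuple in [A], and         *)
(*   (ii) no tuple of points outside [U] is in [A]                               *)
(* form a closed set containing [I]. In each member some [U j] has no least      *)
(* element (otherwise (i) applied to the least elements contradicts (ii)), hence *)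
(* is contained in [I j]. Leftmost members containing a given tuple [b] are      *)
(* arithmetical, and for some [j] they exhaust [I j].                            *)
Lemma separated_arith k (J : nat -> Prop) (dom : nat -> nat -> Prop)
    (lt : nat -> nat -> nat -> Prop) (I : nat -> nat -> Prop) (A : nat -> Prop) :
  (forall j, J j -> j < k) ->
  arith (fun e => J (e 0)) -> arith (fun e => dom (e 0) (e 1)) ->
  arith (fun e => lt (e 0) (e 1) (e 2)) -> arith (fun e => A (e 0)) ->
  (forall j x y, lt j x y -> dom j x) ->
  (forall j x, J j -> I j x -> dom j x) ->
  (forall j x, J j -> I j x -> exists y, I j y /\ lt j y x) ->
  (forall j (S : nat -> Prop), J j -> (forall y, S y -> exists z, S z /\ lt j z y) ->
    forall x, S x -> I j x) ->
  (forall v, (forall j, J j -> I j (dec v j)) -> A v) ->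
  (forall v, (forall j, J j -> dom j (dec v j) /\ ~ I j (dec v j)) -> ~ A v) ->
  exists j, J j /\ arith (fun e => I j (e 0)).
Proof.
move=> Jk aJ adom alt aA lt_dom I_dom I_pred I_max A_I A_nI.
pose B l := exists v, (forall j, J j -> lt j (dec v j) (dec l j)) /\ A v.
have aB : arith (fun e => B (e 0)) by rewrite /B; arith_auto.
pose inside x n v := forall j, J j ->
  dom j (dec v j) /\ (pairn j (dec v j) < n /\ bit (pairn j (dec v j)) x).
pose outside x n v := forall j, J j ->
  dom j (dec v j) /\ (pairn j (dec v j) < n /\ ~ bit (pairn j (dec v j)) x).
pose Con b x n := [/\ forall v, inside x n v -> B v,
  forall v, outside x n v -> ~ A v &
  forall j, J j -> pairn j (dec b j) < n -> bit (pairn j (dec b j)) x].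
have [||b x m n le_mn [h1 h2 h3]|u [au hu]] := @arith_path Con.
- apply: (@eq_arith (fun e => ((forall v, inside (e 1) (e 2) v -> B v) /\
    forall v, outside (e 1) (e 2) v -> ~ A v) /\
    forall j, J j -> pairn j (dec (e 0) j) < e 2 -> bit (pairn j (dec (e 0) j)) (e 1))).
    by move=> e; split=> [[[]]|[]].
  by rewrite /inside /outside; arith_auto.
- move=> b x y n e [h1 h2 h3]; split=> [v hv|v hv|j Jj lt_n].
  + by apply: h1 => j /hv [dj [lt_n bj]]; split=> //; split=> //; apply/(e _ lt_n).
  + apply: h2 => j /hv [dj [lt_n bj]]; split=> //; split=> // bx; apply: bj.
    exact/(e _ lt_n).
  + by apply/(e _ lt_n); exact: h3.
- split=> [v hv|v hv|j Jj lt_m].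
  + apply: h1 => j /hv [dj [lt_m bj]]; split=> //; split=> //.
    exact: leq_trans lt_m le_mn.
  + apply: h2 => j /hv [dj [lt_m bj]]; split=> //; split=> //.
    exact: leq_trans lt_m le_mn.
  + by apply: h3 => //; exact: leq_trans lt_m le_mn.
pose U b j x := dom j x /\ u b (pairn j x).
pose no_least b j := forall y, U b j y -> exists z, U b j z /\ lt j z y.
pose V j x := exists b, no_least b j /\ U b j x.
have V_I j x : J j -> V j x -> I j x.
  by move=> Jj [b [nl Ux]]; exact: I_max Jj nl x Ux.
have aV : arith (fun e => V (e 0) (e 1)).
  by rewrite /V /no_least /U; arith_auto.
apply: contrapT => none.
(* [V j] is arithmetical and contained in [I j]. If it were always a proper subset, some [f j] would
   be missed for each [j]; the member through all these points gives the contradiction. *)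
have /choice [f hf] j : exists x, J j -> I j x /\ ~ V j x.
  have [Jj|] := pselect (J j); last by exists 0.
  apply: contrapT => h; apply: none; exists j; split=> //.
  apply: (@eq_arith (fun e => V j (e 0))); last by arith_auto.
  move=> e; split=> [|Ix]; first exact: V_I.
  by apply: contrapT => nV; apply: h; exists (e 0).
have [b hb] := dec_surj f k.
(* The family [I] itself, cut off at [n], is a node of the tree. *)
have inf n : exists x, Con b x n.
  have [x hx] := bits_of_pred (fun a => `[< exists j y, J j /\ I j y /\ a = pairn j y >]) n.
  have bx j y : J j -> pairn j y < n -> bit (pairn j y) x <-> I j y.
    move=> Jj lt_n; rewrite hx lt_n /=; split=> [/asboolP [i [z [_ [Iz]]]]|Iy].
      by case/pairn_inj => -> ->.
    by apply/asboolP; exists j, y.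
  exists x; split=> [v hv|v hv|j Jj lt_n].
  + have /choice [g hg] j : exists y, J j -> I j y /\ lt j y (dec v j).
      have [Jj|] := pselect (J j); last by exists 0.
      have [_ [lt_n /(bx _ _ Jj lt_n)]] := hv j Jj.
      by case/(I_pred _ _ Jj) => y hy; exists y.
    have [w hw] := dec_surj g k; exists w; split=> [j Jj|].
      by rewrite (hw _ (Jk _ Jj)); have [] := hg j Jj.
    by apply: A_I => j Jj; rewrite (hw _ (Jk _ Jj)); have [] := hg j Jj.
  + apply: A_nI => j Jj; have [dj [lt_n nb]] := hv j Jj; split=> // Ij.
    by apply: nb; apply/(bx _ _ Jj lt_n).
  + by apply/(bx _ _ Jj lt_n); rewrite (hb _ (Jk _ Jj)); have [] := hf j Jj.
have path v : exists x n, (forall j, J j -> pairn j (dec v j) < n) /\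
    (forall a, a < n -> (bit a x <-> u b a)).
  pose n := (\max_(j < k) pairn j (dec v j)).+1.
  have [x hx] := bits_of_pred (fun a => `[< u b a >]) n.
  exists x, n; split=> [j /Jk lt_k|a lt_a]; last by rewrite hx lt_a; split=> /asboolP.
  by rewrite ltnS; exact: (@leq_bigmax _ (fun j : 'I_k => pairn j (dec v j)) (Ordinal lt_k)).
have UB v : (forall j, J j -> U b j (dec v j)) -> B v.
  move=> hv; have [x [n [hn hx]]] := path v; have [h _ _] := hu b inf n x hx.
  by apply: h => j Jj; have [dj uj] := hv j Jj; split=> //; split; [|apply/hx]; auto.
have UA v : (forall j, J j -> dom j (dec v j) /\ ~ U b j (dec v j)) -> ~ A v.
  move=> hv; have [x [n [hn hx]]] := path v; have [_ h _] := hu b inf n x hx.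
  apply: h => j Jj; have [dj uj] := hv j Jj; split=> //; split; first exact: hn.
  by move/(hx _ (hn _ Jj)) => ?; apply: uj.
have Ub j : J j -> U b j (f j).
  move=> Jj; have [x [n [hn hx]]] := path b; have [_ _ h] := hu b inf n x hx.
  split; first by apply: I_dom => //; have [] := hf j Jj.
  by rewrite -(hb _ (Jk _ Jj)); apply/hx; [|apply: h]; auto.
(* [U b j] contains [f j], which is not in [V j], so it cannot be without least element. *)
have all_least j : exists l, J j -> U b j l /\ forall z, U b j z -> ~ lt j z l.
  have [Jj|] := pselect (J j); last by exists 0.
  apply: contrapT => h; have [_] := hf j Jj; apply; exists b; split; last exact: Ub.
  move=> y Uy; apply: contrapT => h'; apply: h; exists y => _; split=> // z Uz lt_z.
  by apply: h'; exists z.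
have /choice [l hl] := all_least; have [v hv] := dec_surj l k.
have [|w [hw Aw]] := UB v.
  by move=> j Jj; rewrite (hv _ (Jk _ Jj)); have [] := hl j Jj.
apply: UA Aw => j Jj; have := hw j Jj; rewrite (hv _ (Jk _ Jj)) => lt_w.
by split=> [|Uw]; [exact: lt_dom lt_w | have [_ /(_ _ Uw)] := hl j Jj].
Qed.

(** * The generic set *)

(** Embedding codes into a countable type of finite trees numbers them, which gives each code its
    stage in the construction. *)
Fixpoint tree_of_code (c : code) : GenTree.tree nat :=
  match c with
  | Zero => GenTree.Leaf 0
  | Succ => GenTree.Leaf 1
  | Query => GenTree.Leaf 2
  | Proj i => GenTree.Node 0 [:: GenTree.Leaf i]
  | Comp f gs => GenTree.Node 1 (tree_of_code f :: map tree_of_code gs)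
  | Prec f g => GenTree.Node 2 [:: tree_of_code f; tree_of_code g]
  | Mu f => GenTree.Node 3 [:: tree_of_code f]
  end.

Lemma tree_of_code_inj : injective tree_of_code.
Proof.
elim/code_nested_ind => [||i||f gs IHf IHg|f g IHf IHg|f IHf] [||i'||f' gs'|f' g'|f'] //=.
- by case=> ->.
- case=> /IHf -> e; congr Comp.
  elim: gs gs' IHg e => [|g gs IH] [|g' gs'] //= IHg [e1 e2].
  have /= -> := IHg 0 (ltn0Sn _) g' e1.
  by rewrite (IH gs') // => i; exact: (IHg i.+1).
- by case=> /IHf -> /IHg ->.
- by case=> /IHf ->.
Qed.

Definition code_index (c : code) : nat := pickle (tree_of_code c).

Lemma code_index_inj : injective code_index.
Proof. by move=> c d /(pcan_inj pickleK) /tree_of_code_inj. Qed.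

(** * Ill-founded parts of linear orders *)

Definition ill_part (L : linear_order) (x : nat) : Prop :=
  exists2 g, descending L g & g 0 = x.

Lemma ill_part_tail L g n : descending L g -> ill_part L (g n).
Proof. by move=> hg; exists (fun i => g (n + i)) => [i|]; rewrite ?addnS ?addn0. Qed.

Lemma ill_part_up L x y : ill_part L x -> lo_lt L x y -> ill_part L y.
Proof.
move=> [g hg g0] lt_xy; exists (fun i => if i is j.+1 then g j else y) => //.
by case=> [|i] /=; rewrite ?g0.
Qed.

Lemma ill_part_pred L x : ill_part L x -> exists y, ill_part L y /\ lo_lt L y x.
Proof. by move=> [g hg <-]; exists (g 1); split=> //; exact: ill_part_tail. Qed.

Lemma ill_part_max L (S : nat -> Prop) :
  (forall y, S y -> exists z, S z /\ lo_lt L z y) -> forall x, S x -> ill_part L x.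
Proof.
move=> hS x Sx.
have /choice [h hh] y : exists z, S y -> S z /\ lo_lt L z y.
  have [/hS [z hz]|] := pselect (S y); by [exists z | exists 0].
have Si n : S (iter n h x) by elim: n => //= n /hh [].
by exists (fun n => iter n h x) => // n; have [] := hh _ (Si n).
Qed.

Lemma ill_part_dom L x : ill_part L x -> lo_dom L x.
Proof. by move=> [g hg <-]; have [] := lo_lt_dom (hg 0). Qed.

(** By upward closure of the ill-founded part, a point outside it cannot be above a point inside. *)
Lemma lt_ill_part L w m :
  lo_dom L w -> ~ ill_part L w -> ill_part L m -> lo_lt L w m.
Proof.
move=> dw nw im; case: (lo_lt_total dw (ill_part_dom im)) => // [e|lt_mw].
  by rewrite e in nw.
by case: nw; exact: ill_part_up lt_mw.
Qed.

Lemma descending_lt L g m n : descending L g -> m < n -> lo_lt L (g n) (g m).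
Proof.
move=> hg; elim: n => // n IH; rewrite ltnS leq_eqVlt => /orP[/eqP -> //|/IH h].
exact: lo_lt_trans (hg n) h.
Qed.

(** Pigeonhole: the values are distinct. The index [l.+1] ensures that the large value is also
    strictly below [g 0]. *)
Lemma descending_unbounded L g M : descending L g -> exists l, M <= g l.+1.
Proof.
move=> hg; apply: contrapT => h.
have lt_M l : g l.+1 < M by rewrite ltnNge; apply/negP => le_M; apply: h; exists l.
pose f (i : 'I_M.+1) : 'I_M := Ordinal (lt_M i).
have inj_f : injective f.
  move=> i j /(congr1 val) /= e; apply: val_inj => /=.
  case: (ltngtP i j) => // [lt_ij|lt_ji].
    by have := @descending_lt L g i.+1 j.+1 hg lt_ij; rewrite e => /lo_lt_irrefl.
  by have := @descending_lt L g j.+1 i.+1 hg lt_ji; rewrite e => /lo_lt_irrefl.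
by have := leq_card f inj_f; rewrite !card_ord ltnn.
Qed.

(** * Conditions and the construction of the generic set *)

Definition lt_at (Ls : nat -> option linear_order) i x y :=
  if Ls i is Some L then lo_lt L x y else False.

Definition dom_at (Ls : nat -> option linear_order) i x :=
  if Ls i is Some L then lo_dom L x else False.

(** The default [True] leaves a column without an order unconstrained; being arithmetical, it never
    enters the set [J] of [extends_avoid]. *)
Definition ill_at (Ls : nat -> option linear_order) i x :=
  if Ls i is Some L then ill_part L x else True.

(* The condition (x, n, k) prescribes membership in the generic set below n by    *)
(* the bits of x, and for i < k keeps later elements of the i-th column inside    *)
(* the ill-founded part of the i-th order.                                        *)
Definition condition : Type := (nat * nat * nat)%type.

Definition extends (Ls : nat -> option linear_order) (q p : condition) : Prop :=
  [/\ p.1.2 <= q.1.2, p.2 <= q.2, agree p.1.2 q.1.1 p.1.1 &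
    forall i m, p.1.2 <= pairn i m -> pairn i m < q.1.2 -> bit (pairn i m) q.1.1 ->
      i < p.2 -> ill_at Ls i m].

Definition admits (Ls : nat -> option linear_order) (p : condition) (D : set nat) : Prop :=
  (forall a, a < p.1.2 -> (D a <-> bit a p.1.1)) /\
  forall i m, p.1.2 <= pairn i m -> D (pairn i m) -> i < p.2 -> ill_at Ls i m.

Lemma extends_trans Ls p q r : extends Ls r q -> extends Ls q p -> extends Ls r p.
Proof.
move=> [n1 k1 e1 h1] [n2 k2 e2 h2]; split.
- exact: leq_trans n2 n1.
- exact: leq_trans k2 k1.
- exact: agree_trans (agreeW n2 e1) e2.
- move=> i m le_n lt_n b lt_k; have [lt_q|le_q] := ltnP (pairn i m) q.1.2.
    by apply: h2 => //; apply/(e1 _ lt_q).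
  by apply: h1 => //; exact: leq_trans lt_k k2.
Qed.

Lemma extends_refl Ls p : extends Ls p p.
Proof. by split=> // i m le_n lt_n; move: (leq_ltn_trans le_n lt_n); rewrite ltnn. Qed.

Lemma extends_grow Ls (p : condition) n k : p.1.2 <= n -> p.2 <= k ->
  exists x, extends Ls (x, n, k) p.
Proof.
(* Clearing all bits from [p.1.2] on keeps new elements out of the columns. *)
move=> le_n le_k; have [x hx] := bits_of_pred (bit^~ p.1.1) p.1.2.
exists x; split=> //= [a lt_a|i m le_p _]; first by rewrite hx lt_a.
by rewrite hx ltnNge le_p.
Qed.

Lemma extends_column Ls p i x N : ill_at Ls i x -> Ls i ->
  exists q, extends Ls q p /\
    exists m, [/\ N <= m, lt_at Ls i m x, pairn i m < q.1.2 & bit (pairn i m) q.1.1].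
Proof.
rewrite /ill_at /lt_at; case Li: (Ls i) => [L|] // [g hg <-] _.
(* The only new element is a value of [g], taken so large as a number that its code lies beyond the
   part already decided. *)
have [l] := descending_unbounded (maxn N p.1.2) hg; rewrite geq_max => /andP[le_N le_n].
set m := g l.+1 in le_N le_n.
have [y hy] := bits_of_pred (fun a => if a < p.1.2 then bit a p.1.1 else a == pairn i m)
  (pairn i m).+1.
have le_p : p.1.2 <= pairn i m := leq_trans le_n (leq_pairn i m).
exists (y, (pairn i m).+1, p.2); split; last first.
  exists m; split=> //=; first exact: descending_lt.
  by rewrite hy ltnSn ltnNge le_p /= eqxx.
split=> //=; first exact: leqW.
  by move=> a lt_a; rewrite hy lt_a ltnS (leq_trans (ltnW lt_a) le_p).
move=> j z le_z lt_z; rewrite hy lt_z ltnNge le_z /= => /eqP /pairn_inj [-> ->] _.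
by rewrite /ill_at Li; exact: ill_part_tail.
Qed.

Lemma extends_avoid (X : set nat) Ls (p : condition) c :
  ~ arith (fun e => X (e 0)) ->
  (forall i L, Ls i = Some L -> computable_order L) ->
  exists q, extends Ls q p /\
    forall D, admits Ls q D -> ~ forall x, eval (chi D) c [:: x] (chi X x).
Proof.
move=> nX comp; case: p => -[x0 n] k.
have alt i : arith (fun e => lt_at Ls i (e 0) (e 1)).
  rewrite /lt_at; case Li: (Ls i) => [L|]; last exact: arith_prop.
  have [_ h] := comp _ _ Li.
  exact: (@arith_base 2 (fun v => lo_lt L (nth 0 v 0) (nth 0 v 1)) [:: 0; 1] h erefl).
have adom i : arith (fun e => dom_at Ls i (e 0)).
  rewrite /dom_at; case Li: (Ls i) => [L|]; last exact: arith_prop.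
  have [h _] := comp _ _ Li.
  exact: (@arith_base 1 (fun v => lo_dom L (nth 0 v 0)) [:: 0] h erefl).
pose J i := i < k /\ ~ arith (fun e => ill_at Ls i (e 0)).
(* Columns outside [J] keep the true constraint, which is arithmetical there. *)
pose col i w m := i < k /\ (J i /\ lt_at Ls i w m \/ ~ J i /\ ill_at Ls i m).
have acol : arith (fun e => col (e 0) (e 1) (e 2)).
  apply: (@arith_slices k (fun i e => J i /\ lt_at Ls i (e 0) (e 1) \/
    ~ J i /\ ill_at Ls i (e 1))) => i lt_k.
  have [Ji|nJ] := pselect (J i).
    by apply: eq_arith (alt i) => e; split=> [|[[]|[]]] //; left.
  have ai : arith (fun e => ill_at Ls i (e 0)) by apply: contrapT => na; apply: nJ.
  apply: eq_arith (arith_ren succn ai) => e.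
  by split=> [|[[]|[]]] //; right.
pose near v x := (forall a, a < n -> (bit a x <-> bit a x0)) /\
  forall i m, n <= pairn i m -> bit (pairn i m) x -> i < k -> col i (dec v i) m.
have anear : arith (fun e => near (e 0) (e 1)) by rewrite /near; arith_auto.
have aeval : arith (fun e => eval (bits (e 0)) c [:: e 1] (e 2)).
  apply: (@arith_eval c (fun e => e 0) [:: fun e => e 1] (fun e => e 2)) => [|[|i]|];
    rewrite ?nth_nil /=; try exact: arith_var.
  by rewrite nth_nil; exact: arith_const.
pose S v a y := exists x, near v x /\ eval (bits x) c [:: a] y.
have aS : arith (fun e => S (e 0) (e 1) (e 2)).
  apply: arith_exists; apply: arith_and; first by arith_auto.
  by apply: (@arith_app3 (fun x a y => eval (bits x) c [:: a] y)) => //; arith_auto.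
pose A v := forall a y z, S v a y -> S v a z -> y = z.
have aA : arith (fun e => A (e 0)) by rewrite /A; arith_auto.
have [[v [hv [a nS]]]|lower] := pselect (exists v,
    (forall j, J j -> dom_at Ls j (dec v j) /\ ~ ill_at Ls j (dec v j)) /\
    exists a, ~ S v a (chi X a)).
  exists (x0, n, k); split=> [|D [/= D1 D2] hD]; first exact: extends_refl.
  apply: nS; have [N hN] := eval_use (hD a).
  have [x hx] := bits_of_pred (fun a => `[< D a >]) (maxn N n).
  exists x; split; last first.
    by apply: hN => b lt_b; rewrite /bits hx leq_max lt_b.
  split=> [b lt_b|i m le_n].
    by rewrite hx leq_max lt_b orbT -D1 //; split=> /asboolP.
  rewrite hx => /andP[_ /asboolP Dm] lt_k; have im := D2 _ _ le_n Dm lt_k.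
  split=> //; have [Ji|nJ] := pselect (J i); [left | by right].
  split=> //; have [] := hv i Ji; move: im; rewrite /lt_at /dom_at /ill_at.
  by case: (Ls i) => // L im dw nw; exact: lt_ill_part.
(* Stronger constraints: a finite set [x] that is [near v] obeys the true ones, so a wrong answer
   from it can be forced by fixing [x] up to the use [N]. *)
have [[v [hv [a [y [[x [[x1 x2] hx]] ne]]]]]|upper] := pselect (exists v,
    (forall j, J j -> ill_at Ls j (dec v j)) /\
    exists a y, S v a y /\ y <> chi X a).
  have [N hN] := eval_use hx.
  exists (x, maxn N n, k); split.
    split=> //=; first exact: leq_maxr.
    move=> i m le_n _ bm lt_k; have [_ [[Ji lt_m]|[_ //]]] := x2 _ _ le_n bm lt_k.
    have := hv i Ji; move: lt_m; rewrite /lt_at /ill_at; case: (Ls i) => // L lt_m iw.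
    exact: ill_part_up iw lt_m.
  move=> D [/= D1 _] hD; apply: ne; apply: eval_det (hD a); apply: hN => b lt_b.
  rewrite /chi /bits; congr nat_of_bool; apply/asboolP/idP => h;
    by apply/D1; rewrite ?leq_max ?lt_b.
have J_some j : J j -> exists L, Ls j = Some L.
  move=> [_]; rewrite /ill_at; case: (Ls j) => [L _|nj]; first by exists L.
  by case: nj; exact: arith_prop.
suff [j [[_ nj] /nj]] : exists j, J j /\ arith (fun e => ill_at Ls j (e 0)) by [].
apply: (@separated_arith k J (fun j x => j < k /\ dom_at Ls j x)
  (fun j x y => j < k /\ lt_at Ls j x y) (ill_at Ls) A) => //.
- by move=> j [].
- by apply: (@arith_slices k (fun i _ => ~ arith (fun e => ill_at Ls i (e 0)))) => i _;
    exact: arith_prop.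
- exact: (@arith_slices k (fun i e => dom_at Ls i (e 0))).
- exact: (@arith_slices k (fun i e => lt_at Ls i (e 0) (e 1))).
- move=> j x y [lt_k]; rewrite /lt_at /dom_at; case: (Ls j) => // L lt_xy.
  by split=> //; have [] := lo_lt_dom lt_xy.
- move=> j x Jj; have [L Lj] := J_some _ Jj; rewrite /ill_at /dom_at Lj => ix.
  by split; [case: Jj | exact: ill_part_dom].
- move=> j x Jj; have [L Lj] := J_some _ Jj; rewrite /ill_at /lt_at Lj => /ill_part_pred.
  by case=> y [iy lt_yx]; exists y; split=> //; split=> //; case: Jj.
- move=> j T Jj hT x Tx; have [L Lj] := J_some _ Jj; move: hT.
  rewrite /ill_at /lt_at Lj => hT; apply: ill_part_max Tx => y /hT [z [Tz [_ lt_zy]]].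
  by exists z.
- move=> v hv a y z; suff h w : S v a w -> w = chi X a by move=> /h -> /h ->.
  by move=> Sw; apply: contrapT => ne; apply: upper; exists v; split=> //; exists a, w.
(* At an outside tuple every right answer arises; if the answers were also consistent, [S v a 1]
   would define [X]. *)
- move=> v hv Av; apply: nX.
  have SX a : S v a (chi X a).
    apply: contrapT => nS; apply: lower; exists v; split; last by exists a.
    by move=> j /hv [[]].
  apply: (@eq_arith (fun e => S v (e 0) 1)); last by arith_auto.
  move=> e; have := SX (e 0); rewrite /chi; have [Xe|nXe] := asboolP (X (e 0)) => // S0.
  by split=> // /(Av _ _ _ S0).
Qed.

Lemma generic_exists (X : set nat) Ls :
  ~ arith (fun e => X (e 0)) ->
  (forall i L, Ls i = Some L -> computable_order L) ->
  exists D : set nat,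
  [/\ ~ turing_le X D,
    forall i, exists N, forall m, N <= m -> D (pairn i m) -> ill_at Ls i m &
    forall i x N, Ls i -> ill_at Ls i x ->
      exists m, [/\ N <= m, lt_at Ls i m x & D (pairn i m)]].
Proof.
move=> nX comp.
(* The number [t] stands at once for a code to diagonalize against and for a triple of column, point
   and bound; the first two clauses make all numbers decided and all columns constrained
   eventually. *)
pose req t (p : condition) := [/\ t <= p.1.2, t <= p.2,
  forall c, code_index c = t -> forall D, admits Ls p D ->
    ~ forall x, eval (chi D) c [:: x] (chi X x) &
  forall i x N, pickle (i, x, N) = t -> Ls i -> ill_at Ls i x ->
    exists m, [/\ N <= m, lt_at Ls i m x, pairn i m < p.1.2 & bit (pairn i m) p.1.1]].
have step t p : exists q, extends Ls q p /\ req t q.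
  have [x ext0] := extends_grow Ls (leq_maxl p.1.2 t) (leq_maxl p.2 t).
  set p0 : condition := (x, _, _) in ext0.
  have [p1 [ext1 h1]] : exists q, extends Ls q p0 /\ forall i y N, pickle (i, y, N) = t ->
      Ls i -> ill_at Ls i y -> exists m,
      [/\ N <= m, lt_at Ls i m y, pairn i m < q.1.2 & bit (pairn i m) q.1.1].
    have [[[[i y] N] [e Li iy]]|none] := pselect (exists u : nat * nat * nat,
        [/\ pickle u = t, Ls u.1.1 & ill_at Ls u.1.1 u.1.2]).
      have [q [extq hq]] := extends_column p0 N iy Li; exists q; split=> // i' y' N'.
      by rewrite -e => /(pcan_inj pickleK) [-> -> ->].
    exists p0; split=> [|i y N e Li iy]; first exact: extends_refl.
    by case: none; exists (i, y, N).
  have [q [ext2 h2]] : exists q, extends Ls q p1 /\ forall c, code_index c = t ->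
      forall D, admits Ls q D -> ~ forall x, eval (chi D) c [:: x] (chi X x).
    have [[c e]|none] := pselect (exists c, code_index c = t).
      have [q [extq hq]] := extends_avoid p1 c nX comp; exists q; split=> // c'.
      by rewrite -e => /code_index_inj ->.
    exists p1; split=> [|c e]; first exact: extends_refl.
    by case: none; exists c.
  exists q; split; first exact: extends_trans ext2 (extends_trans ext1 ext0).
  have [n1 k1 _ _] := extends_trans ext2 ext1.
  split=> //; first exact: leq_trans (leq_maxr _ _) n1.
    exact: leq_trans (leq_maxr _ _) k1.
  move=> i y N e Li iy; have [m [le_N lt_m lt_n bm]] := h1 i y N e Li iy.
  have [n2 _ e2 _] := ext2; exists m; split=> //; first exact: leq_trans lt_n n2.
  exact/(e2 _ lt_n).
have /choice [next hnext] : forall tp : nat * condition, exists q,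
    extends Ls q tp.2 /\ req tp.1 q by move=> [t p]; exact: step.
pose P := fix P t : condition := if t is s.+1 then next (s, P s) else (0, 0, 0).
have PS t : extends Ls (P t.+1) (P t) by have [] := hnext (t, P t).
have Preq t : req t (P t.+1) by have [] := hnext (t, P t).
have mono s t : s <= t -> extends Ls (P t) (P s).
  elim: t => [|t IH]; first by rewrite leqn0 => /eqP ->; exact: extends_refl.
  rewrite leq_eqVlt => /orP[/eqP ->|/IH h]; first exact: extends_refl.
  exact: extends_trans (PS t) h.
pose D : set nat := [set a | exists t, a < (P t).1.2 /\ bit a (P t).1.1]%classic.
have DP t : admits Ls (P t) D.
  split=> [a lt_a|i m le_n [s [lt_s bs]] lt_k].
    split=> [[s [lt_s bs]]|]; last by exists t.
    have [_ _ es _] := mono _ _ (leq_maxl s t).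
    have [_ _ et _] := mono _ _ (leq_maxr s t).
    by apply/(et _ lt_a)/(es _ lt_s).
  have [le_st|lt_ts] := leqP s t.
    have [le_n' _ _ _] := mono _ _ le_st.
    by move: (leq_trans lt_s (leq_trans le_n' le_n)); rewrite ltnn.
  by have [_ _ _ h] := mono _ _ (ltnW lt_ts); exact: h.
exists D; split.
- move=> [c hc]; have [_ _ h _] := Preq (code_index c).
  exact: h erefl _ (DP _) hc.
(* [req i.+1] holds at [P i.+2], so the constraint on column [i] is in force from there on. *)
- move=> i; exists (P i.+2).1.2 => m le_m Dm; have [_ h] := DP i.+2.
  apply: h Dm _; first exact: leq_trans le_m (leq_pairn i m).
  by have [_ lt_k _ _] := Preq i.+1.
- move=> i x N Li ix; have [_ _ _ h] := Preq (pickle (i, x, N)).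
  have [m [le_N lt_m lt_n bm]] := h i x N erefl Li ix.
  by exists m; split=> //; exists (pickle (i, x, N)).+1.
Qed.

(** * Tight descending sequences from the columns *)

Lemma computes_set0 O k f : computes (chi set0) k f -> computes O k f.
Proof.
move=> [c hc]; exists (subst_query Zero c) => v /hc h.
apply: eval_subst_query h => x; have -> : chi set0 x = 0; last exact: eval_zero.
by rewrite /chi asboolF.
Qed.

(** Starting in the ill-founded part, take as next value the numerically first element of the column
    from [N] on that is below the current one. It exists by coinitiality and lies again in the
    ill-founded part. *)
Lemma tight_computable (L : linear_order) (D : set nat) i N :
  computable_order L -> ill_founded L ->
  (forall m, N <= m -> D (pairn i m) -> ill_part L m) ->
  (forall x, ill_part L x -> exists m, [/\ N <= m, lo_lt L m x & D (pairn i m)]) ->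
  exists2 f, tight_descending L f & fun_computable_in D f.
Proof.
move=> [_ comp] [g0 hg0] D_ill D_coinit.
pose cand z m := `[< D (pairn i (N + m)) >] && `[< lo_lt L (N + m) z >].
have cand_ex z : ill_part L z -> exists m, cand z m.
  case/D_coinit => m [le_m lt_m Dm]; exists (m - N).
  by rewrite /cand subnKC //; apply/andP; split; apply/asboolP.
have /choice [next hnext] z : exists m, (exists m, cand z m) ->
    cand z m /\ forall m', m' < m -> ~~ cand z m'.
  have [ex|] := pselect (exists m, cand z m); last by exists 0.
  case: (ex_minnP ex) => m hm min_m; exists m => _; split=> // m' lt_m.
  by apply/negP => /min_m; rewrite leqNgt lt_m.
pose f := fix f n := if n is m.+1 then N + next (f m) else g0 0.
have f_ill n : ill_part L (f n).
  elim: n => [|n IH] /=; first exact: ill_part_tail.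
  have [/andP[/asboolP Dm _] _] := hnext _ (cand_ex _ IH).
  by apply: D_ill Dm; exact: leq_addr.
have f_desc : descending L f.
  by move=> n; have [/andP[_ /asboolP]] := hnext _ (cand_ex _ (f_ill n)).
exists f; first split=> //.
  move=> g hg n; apply: contrapT => none.
  have [m [le_m lt_m Dm]] := D_coinit _ (ill_part_tail n hg).
  have lt_f l : lo_lt L m (f l).
    have [dm _] := lo_lt_dom lt_m.
    case: (lo_lt_total dm (ill_part_dom (f_ill l))) => // [e|lt_fm].
      by case: none; exists l; rewrite -e.
    by case: none; exists l; exact: lo_lt_trans lt_fm lt_m.
  (* Then m would be a candidate at every step, so all values of f would be <= m. *)
  have [l] := descending_unbounded m.+1 f_desc; rewrite ltnNge => /negP; apply.
  rewrite /= -leq_subRL // leqNgt; apply/negP => lt_next.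
  have [_ /(_ _ lt_next)/negP] := hnext _ (cand_ex _ (f_ill l)); apply.
  by rewrite /cand subnKC //; apply/andP; split; apply/asboolP.
have [test htest] : computes (chi D) 2 (fun v => ~~ cand (nth 0 v 1) (nth 0 v 0)).
  have hN : computes (chi D) 2 (fun v => N + nth 0 v 0).
    by apply: computes_add; [exact: computes_const | exact: computes_nth].
  apply: computes_negb; apply: computes_andb.
    apply: (@computes1 _ _ (chi D)); first by exists Query => v _; constructor.
    by apply: computes_pairn => //; exact: computes_const.
  apply: (@computes2 _ _ (fun x y => `[< lo_lt L x y >])) => //.
    exact: computes_set0 comp.
  exact: computes_nth.
have [start hstart] := computes_const (chi D) 0 (g0 0).
have [add hadd] : computes (chi D) 1 (fun v => N + nth 0 v 0).
  by apply: computes_add; [exact: computes_const | exact: computes_nth].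
(* The step code receives [[:: n; f n]]; [Proj 1] passes only the previous value to the search. *)
exists (Prec start (Comp add [:: Comp (Mu test) [:: Proj 1]])) => n.
elim: n => [|n IH]; first by apply: eval_prec0; exact: hstart.
apply: eval_precS IH _; apply: (@eval_comp _ _ _ _ [:: next (f n)]) => //; last first.
  exact: (hadd [:: _]).
case=> // _ /=; apply: (@eval_comp _ _ _ _ [:: f n]) => //.
  by case=> // _; exact: (eval_proj _ 1 [:: n; f n]).
have [hc min_c] := hnext _ (cand_ex _ (f_ill n)).
apply: (@eval_mu _ _ _ _ (fun=> 0)) => [m lt_m|].
  by have := htest [:: m; f n] erefl; rewrite /= min_c.
by have := htest [:: next (f n); f n] erefl; rewrite /= hc.
Qed.

Theorem mainTheorem12 (X : set nat) (HX : ~ arithmetical X) :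
  exists d : turing_degree,
    high_for_tight_descending d /\ ~ degree_computes_set d X.
Proof.
(* Orders are listed under codes of [lo_lt] only. The order chosen at a code may differ from the
   given one, but has the same [lo_lt], on which tightness depends. *)
pose lists i L := [/\ computable_order L, ill_founded L & exists2 c, code_index c = i &
  forall v, size v = 2 -> eval (chi set0) c v `[< lo_lt L (nth 0 v 0) (nth 0 v 1) >]].
have /choice [Ls hLs] i : exists o, if o is Some L then lists i L
    else forall L, ~ lists i L.
  have [[L hL]|none] := pselect (exists L, lists i L); first by exists (Some L).
  by exists None => L hL; apply: none; exists L.
have [||D [nXD D_ill D_coinit]] := @generic_exists X Ls.
- by move/arith_arithmetical.
- by move=> i L Li; have := hLs i; rewrite Li => -[].
have dD : exists A, forall B, turing_equiv B D <-> turing_equiv B A by exists D.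
exists (@TuringDegree (fun B => turing_equiv B D) dD); split; last first.
  by move=> [A [AD _] XA]; apply: nXD; exact: turing_le_trans XA AD.
move=> L cL iL; have [_ [c hc]] := cL.
have lL : lists (code_index c) L by split=> //; exists c.
have := hLs (code_index c); case Li: (Ls (code_index c)) => [L'|]; last by move/(_ L lL).
move=> [cL' iL' [c' /code_index_inj -> hc']].
have eL : lo_lt L' = lo_lt L.
  apply/funext => x; apply/funext => y; apply/propext.
  have := eval_det (hc [:: x; y] erefl) (hc' [:: x; y] erefl).
  by case: asboolP => h; case: asboolP => h' //; split.
have [N hN] := D_ill (code_index c).
have [f tf cf] : exists2 f, tight_descending L' f & fun_computable_in D f.
  apply: (@tight_computable L' D (code_index c) N) => // [m le_m Dm|x ix].
    by have := hN m le_m Dm; rewrite /ill_at Li.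
  have := D_coinit (code_index c) x N; rewrite /ill_at /lt_at Li; exact.
exists f; last by exists D => //; split; exact: turing_le_refl.
by move: tf; rewrite /tight_descending /descending eL.
Qed.
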